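(* The moduli space $\mathcal X$ of $E_6$-quartic threefolds and the moduli space $\mathcal P^I$ of Igusa pencils are rational.
   Context: We work over $\mathbb C$. Let $B\subset\mathbb P^4$ be the Igusa quartic: in $\mathbb P^4=\{z_1+\dots+z_6=0\}\subset\mathbb P^5$ it has equation $b=\sum z_i^4-\frac14(\sum z_i^2)^2=0$. The group $\mathrm{Aut}\,B\cong\mathfrak S_6$ acts on $\mathbb P^4$ linearly by permutation of the coordinates $z_i$. An Igusa pencil is a pencil of quartic threefolds $\{\lambda a^2+\mu b=0\}$, $(\lambda:\mu)\in\mathbb P^1$, where $a$ is a non-zero quadratic form on $\mathbb P^4$. An element of an Igusa pencil is called an $E_6$-quartic threefold. Let $\mathbb V\subset|\mathcal O_{\mathbb P^4}(4)|$ be the union of all Igusa pencils; it is a cone with vertex $B$ over the family of double quadrics $\mathbb V_2=\{2A\mid A\in|\mathcal O_{\mathbb P^4}(2)|\}$, and $\mathbb V_2$ parametrizes the Igusa pencils. The moduli spaces are the GIT quotients $\mathcal X=\mathbb V/\!/\mathfrak S_6$ and $\mathcal P^I=\mathbb V_2/\!/\mathfrak S_6$. *)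

(* Defs.v *)
From HB Require Import structures.
From mathcomp Require Import all_boot all_order all_algebra all_fingroup.
From mathcomp Require Import fraction ring_quotient mpoly.
From mathcomp Require Import boolp reals complex.
From mathcomp Require Import ring.

Set Implicit Arguments.
Unset Strict Implicit.
Unset Printing Implicit Defensive.

Import GRing.Theory.
Local Open Scope ring_scope.
Local Open Scope quotient_scope.

Local Notation "x %:F" := (@tofrac _ x).

(* A projective variety with a linear action of a finite group.  A subset of  *)
(* P(W) is encoded by the set [gv_pts] of the nonzero vectors representing    *)
(* its points (the zero vector is irrelevant).  Closedness is not recorded:   *)
(* everything below depends only on the Zariski closure of the subset.        *)

Section Evaluation.
Variables (F : fieldType) (W : vectType F).

Definition coords (w : W) (i : 'I_(\dim {:W})) : F := coord (vbasis {:W}) i w.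

(* A form on W is a polynomial in the coordinates relative to [vbasis]; the   *)
(* notions below do not depend on the chosen basis.                           *)
Definition vanishes (X : W -> Prop) (P : {mpoly F[\dim {:W}]}) : Prop :=
  forall w, X w -> P.@[coords w] = 0.

End Evaluation.

Record gvariety (F : closedFieldType) (gT : finGroupType) (W : vectType F) :=
  GVariety {
    gv_pts : W -> Prop;
    gv_act : {action gT &-> W};
    gv_nonempty : exists2 w, gv_pts w & w != 0;
    gv_scale : forall (c : F) w, c != 0 -> gv_pts w -> gv_pts (c *: w);
    (* the ideal of gv_pts is prime, i.e. its Zariski closure is irreducible *)
    gv_irreducible : forall P Q, vanishes gv_pts (P * Q) ->
      vanishes gv_pts P \/ vanishes gv_pts Q;
    gv_linear : forall g, linear (fun w => gv_act w g);
    gv_stable : forall g w, gv_pts w -> gv_pts (gv_act w g) }.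

Section CoordinateRing.
Variables (F : closedFieldType) (gT : finGroupType) (W : vectType F).
Variable X : gvariety gT W.

Local Notation S := {mpoly F[\dim {:W}]}.

Definition gv_ideal : {pred S} := fun P => `[< vanishes (gv_pts X) P >].

Lemma gv_idealP P : reflect (vanishes (gv_pts X) P) (P \in gv_ideal).
Proof. exact: asboolP. Qed.

Fact gv_ideal_idealr : idealr_closed gv_ideal.
Proof.
split.
- by apply/gv_idealP => w _; rewrite meval0.
- apply/gv_idealP => h; have [w Xw _] := gv_nonempty X.
  by have /eqP := h w Xw; rewrite meval1 oner_eq0.
- move=> a u v /gv_idealP hu /gv_idealP hv; apply/gv_idealP => w Xw.
  by rewrite mevalD mevalM hu // hv // mulr0 addr0.
Qed.

Fact gv_ideal_prime : prime_idealr_closed gv_ideal.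
Proof.
move=> u v /gv_idealP /gv_irreducible [h|h]; apply/orP; [left|right];
  exact/gv_idealP.
Qed.

HB.instance Definition _ := isIdealr.Build S gv_ideal gv_ideal_idealr.
HB.instance Definition _ := isPrimeIdealrClosed.Build S gv_ideal gv_ideal_prime.

(* The homogeneous coordinate ring of X.                                      *)
Definition coord_ring := {ideal_quot gv_ideal}.

HB.instance Definition _ := GRing.ComNzRing.on coord_ring.

Definition coord_of (P : S) : coord_ring := \pi_({ideal_quot gv_ideal}) P.

Fact coord_of_zmod_morphism : zmod_morphism coord_of.
Proof. by move=> P Q; rewrite /coord_of rmorphB. Qed.
Fact coord_of_monoid_morphism : monoid_morphism coord_of.
Proof. by split=> [|P Q]; rewrite /coord_of ?rmorph1 ?rmorphM. Qed.
HB.instance Definition _ :=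
  GRing.isZmodMorphism.Build S coord_ring coord_of coord_of_zmod_morphism.
HB.instance Definition _ :=
  GRing.isMonoidMorphism.Build S coord_ring coord_of coord_of_monoid_morphism.

Lemma coord_of_eq0 P : (coord_of P == 0) = (P \in gv_ideal).
Proof.
rewrite -(rmorph0 coord_of) /coord_of.
by rewrite -[LHS](Quotient.idealrBE gv_ideal) subr0.
Qed.

Let is_unit : pred coord_ring := fun x => `[< exists y, y * x = 1 >].
Let inv (x : coord_ring) : coord_ring :=
  if pselect (exists y, y * x = 1) is left h then projT1 (cid h) else x.

Fact coord_ring_mulVx : {in is_unit, left_inverse 1 inv *%R}.
Proof.
move=> x /asboolP h; rewrite /inv.
by case: pselect => // h'; case: (cid h').
Qed.
Fact coord_ring_unitPl x y : y * x = 1 -> is_unit x.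
Proof. by move=> h; apply/asboolP; exists y. Qed.
Fact coord_ring_invr_out : {in [predC is_unit], inv =1 id}.
Proof.
by move=> x /negP hx; rewrite /inv; case: pselect => // h; case: hx; apply/asboolP.
Qed.
HB.instance Definition _ := GRing.ComNzRing_hasMulInverse.Build coord_ring
  coord_ring_mulVx coord_ring_unitPl coord_ring_invr_out.

Fact coord_ring_integral : GRing.integral_domain_axiom coord_ring.
Proof. exact: (@Quotient.rquot_IdomainAxiom _ gv_ideal). Qed.
HB.instance Definition _ :=
  GRing.ComUnitRing_isIntegral.Build coord_ring coord_ring_integral.

End CoordinateRing.

Section Subfield.
Variables (K : fieldType) (S : divringClosed K).

Record subfield_of := SubfieldOf { subfield_val :> K; _ : subfield_val \in S }.

HB.instance Definition _ := [isSub for subfield_val].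
HB.instance Definition _ := [Choice of subfield_of by <:].
HB.instance Definition _ := [SubChoice_isSubIntegralDomain of subfield_of by <:].
HB.instance Definition _ := [SubIntegralDomain_isSubField of subfield_of by <:].

End Subfield.

(* The GIT quotient X // G is Proj of the graded ring of G-invariants of the  *)
(* homogeneous coordinate ring C[X]; its function field is the field of       *)
(* fractions f / h, with f, h invariants of the same degree and h nonzero.    *)
(* For finite G every point is semistable, so there is no unstable locus.     *)

Section GITQuotient.
Variables (F : closedFieldType) (gT : finGroupType) (W : vectType F).
Variable X : gvariety gT W.

Local Notation S := {mpoly F[\dim {:W}]}.

Definition invariant_form (d : nat) (f : coord_ring X) : Prop :=
  exists P : S, [/\ f = coord_of X P, P \is d.-homog &
    forall g w, gv_pts X w -> P.@[coords (gv_act X w g)] = P.@[coords w]].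

Definition git_fractions : {pred {fraction coord_ring X}} := fun x =>
  `[< exists d f h, [/\ invariant_form d f, invariant_form d h, h != 0 &
        x = f%:F / h%:F] >].

Lemma invariant_formB d f h :
  invariant_form d f -> invariant_form d h -> invariant_form d (f - h).
Proof.
move=> [P [-> hP iP]] [Q [-> hQ iQ]]; exists (P - Q); rewrite rmorphB.
by split=> [//||g w Xw]; rewrite ?rpredB // !mevalB iP // iQ.
Qed.

Lemma invariant_formM d e f h :
  invariant_form d f -> invariant_form e h -> invariant_form (d + e) (f * h).
Proof.
move=> [P [-> hP iP]] [Q [-> hQ iQ]]; exists (P * Q); rewrite rmorphM.
by split=> [//||g w Xw]; [exact: dhomogM | rewrite !mevalM iP // iQ].
Qed.

Lemma invariant_formC c : invariant_form 0 (coord_of X c%:MP).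
Proof.
exists c%:MP; split=> // [|g w _]; last by rewrite !mevalC.
by rewrite -[c%:MP]mulr1 mul_mpolyC rpredZ // dhomog1.
Qed.

Fact git_constP c : (coord_of X c%:MP)%:F \in git_fractions.
Proof.
apply/asboolP; exists 0%N, (coord_of X c%:MP), (coord_of X 1%:MP).
split; [exact: invariant_formC | exact: invariant_formC | |];
  rewrite mpolyC1 rmorph1 ?oner_neq0 //.
by rewrite tofrac1 divr1.
Qed.

Fact git_fractions_divring_closed : divring_closed git_fractions.
Proof.
split.
- by have := git_constP 1; rewrite mpolyC1 rmorph1 tofrac1.
- move=> _ _ /asboolP[d [f [h [hf hh h0 ->]]]] /asboolP[e [f' [h' [hf' hh' h'0 ->]]]].
  apply/asboolP; exists (d + e)%N, (f * h' - f' * h), (h * h'); split.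
  + apply: invariant_formB; first exact: invariant_formM.
    by rewrite addnC; apply: invariant_formM.
  + exact: invariant_formM.
  + by rewrite mulf_neq0.
  + rewrite tofracB !tofracM -mulNr addf_div ?tofrac_eq0 //.
    by rewrite mulNr.
- move=> _ _ /asboolP[d [f [h [hf hh h0 ->]]]] /asboolP[e [f' [h' [hf' hh' h'0 ->]]]].
  apply/asboolP; have [->|f'0] := eqVneq f' 0.
    exists 0%N, (coord_of X 0%:MP), (coord_of X 1%:MP).
    split; [exact: invariant_formC | exact: invariant_formC | |];
      rewrite mpolyC1 ?mpolyC0 rmorph1 ?oner_neq0 //.
    by rewrite !rmorph0 !mul0r invr0 mulr0.
  exists (d + e)%N, (f * h'), (h * f'); split.
  + exact: invariant_formM.
  + exact: invariant_formM.
  + by rewrite mulf_neq0.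
  + by rewrite !tofracM invf_div mulf_div.
Qed.

HB.instance Definition _ := GRing.isDivringClosed.Build {fraction coord_ring X}
  git_fractions git_fractions_divring_closed.

Definition git_function_field := subfield_of git_fractions.

Definition git_const (c : F) : git_function_field := SubfieldOf (git_constP c).

(* X // G is rational: its function field is isomorphic, as an extension of   *)
(* F, to a field of rational functions F(t_1, ..., t_n).                      *)
Definition git_quotient_rational : Prop :=
  exists (n : nat)
    (phi : {rmorphism git_function_field -> {fraction {mpoly F[n]}}}),
    bijective phi /\ forall c : F, phi (git_const c) = (c%:MP)%:F.

End GITQuotient.

Section PolynomialCurves.
Variables (F : closedFieldType) (W : vectType F).

Definition is_poly (f : F -> F) := exists p : {poly F}, forall t, p.[t] = f t.

Lemma is_poly_meval n (P : {mpoly F[n]}) (v : F -> 'I_n -> F) :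
  (forall i, is_poly (v^~ i)) -> is_poly (fun t => P.@[v t]).
Proof.
move=> hv; have [q hq] := choice hv.
exists (\sum_(m <- msupp P) P@_m *: \prod_i q i ^+ m i) => t.
rewrite mevalE horner_sum; apply: eq_bigr => m _.
rewrite hornerZ horner_prod; congr (_ * _); apply: eq_bigr => i _.
by rewrite horner_exp hq.
Qed.

Lemma is_poly_coords (s : seq W) i :
  is_poly (fun t => coords (\sum_(k < size s) t ^+ k *: s`_k) i).
Proof.
exists (\poly_(k < size s) coords s`_k i) => t.
rewrite horner_poly /coords linear_sum; apply: eq_bigr => k _.
by rewrite linearZ /= mulrC.
Qed.

Lemma curves_irreducible (X : W -> Prop) :
  (forall w1 w2, X w1 -> X w2 -> exists (s : seq W) (d : {poly F}),
    let w t := \sum_(k < size s) t ^+ k *: s`_k in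
    [/\ w 0 = w1, w 1 = w2, d != 0 & forall t, d.[t] != 0 -> X (w t)]) ->
  forall P Q, vanishes X (P * Q) -> vanishes X P \/ vanishes X Q.
Proof.
move=> hX P Q hPQ; apply: contrapT => /not_orP[nP nQ].
have ex (T : {mpoly F[\dim {:W}]}) :
    ~ vanishes X T -> exists2 w, X w & T.@[coords w] != 0.
  move=> nT; apply: contrapT => h; apply: nT => w Xw.
  by apply/eqP; apply: contrapT => /negP h'; apply: h; exists w.
have [w1 X1 h1] := ex P nP; have [w2 X2 h2] := ex Q nQ.
have [s [d [e0 e1 d0 hd]]] := hX _ _ X1 X2.
have [p hp] := is_poly_meval P (is_poly_coords s).
have [q hq] := is_poly_meval Q (is_poly_coords s).
have p0 : p != 0.
  by apply: contra_neq h1 => p0; rewrite -e0 -hp p0 horner0.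
have q0 : q != 0.
  by apply: contra_neq h2 => q0; rewrite -e1 -hq q0 horner0.
have /closed_nonrootP[t] : p * q * d != 0 by rewrite !mulf_neq0.
rewrite !rootM !negb_or => /andP[/andP[pt qt] dt].
have := hPQ _ (hd t dt); rewrite mevalM -hp -hq => /eqP.
by rewrite mulf_eq0 -[_ == 0]/(root p t) -[X in _ || X]/(root q t) (negPf pt) (negPf qt).
Qed.

End PolynomialCurves.

Section E6Quartics.
Variable C : numClosedFieldType.

(* P^4 is the hyperplane z_1 + ... + z_6 = 0 of P^5, on which z_1, ..., z_5    *)
(* are homogeneous coordinates; [zcoord i] is the restriction of z_(i+1).     *)

Definition zcoord (i : 'I_6) : {mpoly C[5]} :=
  if unlift ord_max i is Some j then 'X_j else - \sum_(j < 5) 'X_j.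

Definition quadric_form := dhomog 5 C 2.
Definition quartic_form := dhomog 5 C 4.

Definition igusa : {mpoly C[5]} :=
  \sum_(i < 6) zcoord i ^+ 4 - 4^-1 *: (\sum_(i < 6) zcoord i ^+ 2) ^+ 2.

(* Pullback of a form along a permutation of the six coordinates z_i (see     *)
(* [permute_zcoord]).                                                         *)
Definition permute_z (s : 'S_6) (p : {mpoly C[5]}) : {mpoly C[5]} :=
  p \mPo [tuple zcoord (s (lift ord_max j)) | j < 5].

Lemma zcoord_lift j : zcoord (lift ord_max j) = 'X_j.
Proof. by rewrite /zcoord liftK. Qed.

Lemma zcoord_max : zcoord ord_max = - \sum_(j < 5) 'X_j.
Proof. by rewrite /zcoord unlift_none. Qed.

Lemma sum_zcoord : \sum_(i < 6) zcoord i = 0.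
Proof.
rewrite big_ord_recr /= zcoord_max; apply/eqP; rewrite subr_eq0; apply/eqP.
apply: eq_bigr => j _; rewrite -zcoord_lift; congr zcoord; apply: val_inj.
by rewrite /= /bump leqNgt ltn_ord.
Qed.

Lemma permute_zcoord s i : permute_z s (zcoord i) = zcoord (s i).
Proof.
rewrite /permute_z.
have lift_case j : zcoord (lift ord_max j) \mPo
    [tuple zcoord (s (lift ord_max j)) | j < 5] = zcoord (s (lift ord_max j)).
  by rewrite zcoord_lift comp_mpolyXU -tnth_nth tnth_mktuple.
case: (unliftP ord_max i) => [j ->|->]; first exact: lift_case.
have /(congr1 (comp_mpoly [tuple zcoord (s (lift ord_max j)) | j < 5])) := sum_zcoord.
rewrite raddf_sum raddf0 => h0.
have := sum_zcoord; rewrite (reindex_inj (@perm_inj _ s)) /= -[RHS]h0.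
rewrite (bigD1 ord_max) //= [X in _ = X](bigD1 ord_max) //= => h.
apply/esym/(addIr (\sum_(i < 6 | i != ord_max) zcoord (s i))); rewrite h.
congr (_ + _); apply: eq_bigr => k hk.
by case: (unliftP ord_max k) hk => [j -> _|->]; rewrite ?eqxx // lift_case.
Qed.

Lemma permute_zM s t p : permute_z t (permute_z s p) = permute_z (s * t)%g p.
Proof.
rewrite /permute_z [p \mPo _ in LHS]comp_mpolyEX raddf_sum /= [RHS]comp_mpolyEX.
apply: eq_bigr => m _; rewrite comp_mpolyZ !comp_mpolyX rmorph_prod.
congr (_ *: _); apply: eq_bigr => j _; rewrite rmorphXn !tnth_mktuple; congr (_ ^+ _).
by rewrite [LHS]permute_zcoord permM.
Qed.

Lemma permute_z1 p : permute_z 1%g p = p.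
Proof.
apply: etrans (comp_mpoly_id p); congr comp_mpoly.
by apply: eq_from_tnth => j; rewrite !tnth_mktuple perm1 zcoord_lift.
Qed.

Lemma zcoord_homog i : zcoord i \is 1.-homog.
Proof.
rewrite /zcoord; case: unlift => [j|]; first by rewrite dhomogX /= mdeg1.
by rewrite rpredN rpred_sum // => j _; rewrite dhomogX /= mdeg1.
Qed.

Lemma zcoord_exp_homog i k : zcoord i ^+ k \is k.-homog.
Proof. by have := dhomogMn k (zcoord_homog i); rewrite mul1n. Qed.

Lemma permute_z_homog d s p : p \is d.-homog -> permute_z s p \is d.-homog.
Proof.
move=> hp; rewrite /permute_z comp_mpolyEX big_seq rpred_sum //= => m hm.
rewrite rpredZ //.
have <- : mdeg m = d by exact: (dhomog_mf hp).
rewrite comp_mpolyX mdegE.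
elim/big_ind2: _ => [|a p1 b p2 h1 h2|j _]; first exact: dhomog1.
  exact: dhomogM.
rewrite tnth_mktuple; exact: zcoord_exp_homog.
Qed.

Lemma permute_z_igusa s : permute_z s igusa = igusa.
Proof.
rewrite /igusa /permute_z raddfB /= comp_mpolyZ rmorphXn !raddf_sum /=.
congr (_ - _ *: _ ^+ 2); rewrite [RHS](reindex_inj (@perm_inj _ s)) /=;
  apply: eq_bigr => i _; rewrite rmorphXn; congr (_ ^+ _);
  exact: permute_zcoord.
Qed.

Lemma igusa_homog : igusa \is 4.-homog.
Proof.
have h k : \sum_(i < 6) zcoord i ^+ k \is k.-homog.
  by rewrite rpred_sum // => i _; exact: zcoord_exp_homog.
apply: rpredB; first exact: h.
by apply: rpredZ; exact: (dhomogMn 2 (h 2)).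
Qed.

Definition quartic_perm (p : quartic_form) (s : 'S_6) : quartic_form :=
  DHomog (permute_z_homog s (dhomog_is_dhomog p)).

Fact quartic_perm_id : quartic_perm^~ 1%g =1 id.
Proof. by move=> p; apply/val_inj/permute_z1. Qed.

Fact quartic_permM p : act_morph quartic_perm p.
Proof. by move=> s t; apply/val_inj; rewrite /= permute_zM. Qed.

Definition quartic_act : {action 'S_6 &-> quartic_form} :=
  TotalAction quartic_perm_id quartic_permM.

Fact quartic_act_linear s : linear (fun p => quartic_act p s).
Proof. by move=> c p q; apply/val_inj; rewrite /= /permute_z linearP. Qed.

Definition in_igusa_pencil (a : quadric_form) (p : quartic_form) : Prop :=
  exists l m : C, (l, m) != (0, 0) /\
    (p : {mpoly C[5]}) = l *: (a : {mpoly C[5]}) ^+ 2 + m *: igusa.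

Definition is_E6_quartic (p : quartic_form) : Prop :=
  exists2 a : quadric_form, a != 0 & in_igusa_pencil a p.

Definition is_double_quadric (p : quartic_form) : Prop :=
  exists (a : quadric_form) (l : C), [/\ a != 0, l != 0 &
    (p : {mpoly C[5]}) = l *: (a : {mpoly C[5]}) ^+ 2].

Definition quadricM (a b : quadric_form) : quartic_form :=
  DHomog (dhomogM (dhomog_is_dhomog a) (dhomog_is_dhomog b)).

Lemma pencil_curve (a1 a2 : quadric_form) (l1 l2 m1 m2 : C) :
  exists s : seq quartic_form, forall t,
    (\sum_(k < size s) t ^+ k *: s`_k : quartic_form) =
      (l1 + t * (l2 - l1)) *: quadricM (a1 + t *: (a2 - a1)) (a1 + t *: (a2 - a1))
      + (m1 + t * (m2 - m1)) *: DHomog igusa_homog.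
Proof.
pose d := a2 - a1; pose B : quartic_form := DHomog igusa_homog.
exists [:: l1 *: quadricM a1 a1 + m1 *: B;
  (l1 *+ 2) *: quadricM a1 d + (l2 - l1) *: quadricM a1 a1 + (m2 - m1) *: B;
  l1 *: quadricM d d + ((l2 - l1) *+ 2) *: quadricM a1 d;
  (l2 - l1) *: quadricM d d] => t.
rewrite !big_ord_recl big_ord0 /= addr0; apply/val_inj.
rewrite /= -/d -!mul_mpolyC.
rewrite !(rmorphD, rmorphB, rmorphM, rmorphXn, rmorphMn) /=.
ring.
Qed.

Lemma coef_curve (a1 a2 : quadric_form) : a1 != 0 ->
  exists2 d : {poly C}, d != 0 & forall t, d.[t] != 0 -> a1 + t *: (a2 - a1) != 0.
Proof.
move=> a10; have [m hm] : exists m, (a1 : {mpoly C[5]})@_m != 0.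
  exists (mlead a1); rewrite mleadc_eq0; apply: contra_neq a10 => h.
  exact: val_inj.
pose c (p : quadric_form) := (p : {mpoly C[5]})@_m.
exists ((c a1)%:P + (c (a2 - a1)) *: 'X).
  apply/eqP => /(congr1 (horner^~ 0)) /eqP.
  by rewrite hornerD hornerC hornerZ hornerX mulr0 addr0 horner0 (negPf hm).
move=> t; rewrite hornerD hornerC hornerZ hornerX; apply: contra_neq => h.
have := congr1 c h.
by rewrite /c /= mcoeff0 mcoeffD mcoeffZ mulrC.
Qed.

Lemma scalar_curve (l1 l2 : C) : l1 != 0 ->
  exists2 d : {poly C}, d != 0 & forall t, d.[t] != 0 -> l1 + t * (l2 - l1) != 0.
Proof.
move=> l10; exists (l1%:P + (l2 - l1) *: 'X).
  apply/eqP => /(congr1 (horner^~ 0)) /eqP.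
  by rewrite hornerD hornerC hornerZ hornerX mulr0 addr0 horner0 (negPf l10).
by move=> t; rewrite hornerD hornerC hornerZ hornerX mulrC.
Qed.

Fact E6_irreducible P Q : vanishes is_E6_quartic (P * Q) ->
  vanishes is_E6_quartic P \/ vanishes is_E6_quartic Q.
Proof.
apply: curves_irreducible => w1 w2 [a1 a10 [l1 [m1 [lm1 e1]]]] [a2 _ [l2 [m2 [_ e2]]]].
have [s hs] := pencil_curve a1 a2 l1 l2 m1 m2.
have [da da0 hda] := coef_curve a2 a10.
have [dl dl0 hdl] : exists2 d : {poly C}, d != 0 & forall t, d.[t] != 0 ->
    (l1 + t * (l2 - l1), m1 + t * (m2 - m1)) != (0, 0).
  move: lm1; rewrite xpair_eqE negb_and => /orP[h|h].
    have [d d0 hd] := scalar_curve l2 h; exists d => // t /hd.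
    by rewrite xpair_eqE => /negPf ->.
  have [d d0 hd] := scalar_curve m2 h; exists d => // t /hd.
  by rewrite xpair_eqE andbC => /negPf ->.
exists s, (da * dl); split.
- rewrite hs; apply/val_inj; rewrite /= e1.
  by rewrite !mul0r !addr0 !scale0r addr0 expr2.
- rewrite hs; apply/val_inj; rewrite /= e2.
  by rewrite !mul1r !scale1r !subrKC expr2.
- by rewrite mulf_neq0.
- move=> t; rewrite hornerM mulf_eq0 negb_or => /andP[ha hl].
  exists (a1 + t *: (a2 - a1)); first exact: hda.
  exists (l1 + t * (l2 - l1)), (m1 + t * (m2 - m1)).
  by split; [exact: hdl | rewrite hs /= expr2].
Qed.

Fact double_quadric_irreducible P Q : vanishes is_double_quadric (P * Q) ->
  vanishes is_double_quadric P \/ vanishes is_double_quadric Q.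
Proof.
apply: curves_irreducible => w1 w2 [a1 [l1 [a10 l10 e1]]] [a2 [l2 [_ _ e2]]].
have [s hs] := pencil_curve a1 a2 l1 l2 0 0.
have [da da0 hda] := coef_curve a2 a10.
have [dl dl0 hdl] := scalar_curve l2 l10.
exists s, (da * dl); split.
- rewrite hs; apply/val_inj; rewrite /= e1.
  by rewrite !mul0r !addr0 !scale0r !addr0 expr2.
- rewrite hs; apply/val_inj; rewrite /= e2.
  by rewrite !mul1r !scale1r !subrKC scale0r addr0 expr2.
- by rewrite mulf_neq0.
- move=> t; rewrite hornerM mulf_eq0 negb_or => /andP[ha hl].
  exists (a1 + t *: (a2 - a1)), (l1 + t * (l2 - l1)).
  split; [exact: hda | exact: hdl | rewrite hs /= expr2].
  by rewrite subr0 mulr0 addr0 scale0r addr0.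
Qed.

Lemma permute_quadric (a : quadric_form) s : a != 0 ->
  exists2 a' : quadric_form, a' != 0 & (a' : {mpoly C[5]}) = permute_z s a.
Proof.
move=> a0; exists (DHomog (permute_z_homog s (dhomog_is_dhomog a))) => //.
apply: contra_neq a0 => /(congr1 val) /= h; apply: val_inj => /=.
by rewrite -(permute_z1 a) -(mulgV s) -permute_zM h /permute_z raddf0.
Qed.

Fact E6_stable s p : is_E6_quartic p -> is_E6_quartic (quartic_act p s).
Proof.
move=> [a a0 [l [m [lm e]]]]; have [a' a'0 ea] := permute_quadric s a0.
exists a' => //; exists l, m; split=> //=; rewrite e ea -{2}(permute_z_igusa s) /permute_z.
by rewrite comp_mpolyD !comp_mpolyZ rmorphXn.
Qed.

Fact double_quadric_stable s p :
  is_double_quadric p -> is_double_quadric (quartic_act p s).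
Proof.
move=> [a [l [a0 l0 e]]]; have [a' a'0 ea] := permute_quadric s a0.
by exists a', l; split=> //=; rewrite e ea /permute_z comp_mpolyZ rmorphXn.
Qed.

Fact E6_scale (c : C) p : c != 0 -> is_E6_quartic p -> is_E6_quartic (c *: p).
Proof.
move=> c0 [a a0 [l [m [lm e]]]]; exists a => //; exists (c * l), (c * m); split=> //.
  by move: lm; rewrite !xpair_eqE !mulf_eq0 (negPf c0).
by rewrite /= e scalerDr !scalerA.
Qed.

Fact double_quadric_scale (c : C) p :
  c != 0 -> is_double_quadric p -> is_double_quadric (c *: p).
Proof.
move=> c0 [a [l [a0 l0 e]]]; exists a, (c * l); split=> //.
  by rewrite mulf_neq0.
by rewrite /= e scalerA.
Qed.

Fact double_quadric_nonempty : exists2 p, is_double_quadric p & p != 0.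
Proof.
have h : ('X_0 ^+ 2 : {mpoly C[5]}) \is 2.-homog.
  by rewrite -(zcoord_lift 0); exact: zcoord_exp_homog.
have X0 : ('X_0 : {mpoly C[5]}) != 0.
  by apply/eqP => /(congr1 (mcoeff U_(0))) /eqP; rewrite mcoeffX eqxx mcoeff0 oner_eq0.
have a0 : (DHomog h : quadric_form) != 0.
  by rewrite -(inj_eq val_inj) /= expf_neq0.
exists (quadricM (DHomog h) (DHomog h)).
  by exists (DHomog h), 1; rewrite oner_eq0 scale1r.
by rewrite -(inj_eq val_inj) /= mulf_neq0 ?expf_neq0.
Qed.

Fact E6_nonempty : exists2 p, is_E6_quartic p & p != 0.
Proof.
have [p [a [l [a0 l0 e]]] p0] := double_quadric_nonempty.
exists p => //; exists a => //; exists l, 0; split=> //.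
  by rewrite xpair_eqE (negPf l0).
by rewrite scale0r addr0.
Qed.

Definition E6_quartics : gvariety 'S_6 quartic_form :=
  GVariety E6_nonempty E6_scale E6_irreducible quartic_act_linear E6_stable.

Definition double_quadrics : gvariety 'S_6 quartic_form :=
  GVariety double_quadric_nonempty double_quadric_scale
    double_quadric_irreducible quartic_act_linear double_quadric_stable.

End E6Quartics.

(* Main.v *)
Require Import Defs.
From HB Require Import structures.
From mathcomp Require Import all_boot all_order all_algebra all_fingroup.
From mathcomp Require Import fraction ring_quotient mpoly.
From mathcomp Require Import boolp reals complex.
From mathcomp Require Import ring.

Set Implicit Arguments.
Unset Strict Implicit.
Unset Printing Implicit Defensive.

Import GRing.Theory Num.Theory.
Local Open Scope ring_scope.

Local Notation "x %:F" := (@tofrac _ x).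

(* The forms z_i z_j, i < j, are a basis of the quadratic forms on P^4, and   *)
(* S_6 permutes them: a quadric is a symmetric 6 x 6 matrix a with zero       *)
(* diagonal.  Its row sums y_i are permuted by S_6, and the moments           *)
(* L_kl = sum_ij a_ij y_i^k y_j^l are invariant.  By Lagrange interpolation   *)
(* the L_kl with k, l <= 4 determine a rationally once the y_i are distinct;  *)
(* L_0l is a power sum of the y_i, and L_14 is redundant, which leaves nine   *)
(* moments, and they take arbitrary values for given y by a dimension count   *)
(* (6 + 9 = 15).  Hence, on the slice sum y_i = 1, the field of invariants is *)
(* generated by the algebraically independent elementary symmetric functions  *)
(* e_2(y), ..., e_6(y) and the nine moments.  For the E_6-quartics a^2 + m b  *)
(* there is one more coordinate m.  That a (up to sign) and m are rational in *)
(* the quartic follows from the singularities of b.                           *)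

(** * Rationality of function fields of GIT quotients *)

(** An element of the varieties is a quartic p = a^2 + m b, with m = 0 for double quadrics, and the
    pairs (c a, c^2 m) give proportional quartics. Requiring that the entries of the matrix of a sum
    to 1 fixes both the scale and the sign, so almost every class of quartics meets this affine
    slice in one point. The function field of the quotient thus becomes the field of S_6-invariant
    rational functions on the slice, and it is freely generated by e_2(y), ..., e_6(y), the nine
    moments and, for E_6-quartics, m: 15 coordinates for E_6-quartics and 14 for pencils.

    [rational_by_coordinates] reduces rationality to three facts about these coordinates. They are
    quotients of invariant forms in p ([slice_numerators]): [pencil_recovery] finds m and the
    products of two entries of a from p, and on the slice such products give a itself. They are
    algebraically independent ([slice_independent]): by [esyms_surj] and [quadric_of_data] they take
    generic values. They generate ([slice_generate]): by [lagrange_edge] the entries of a are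
    polynomials in the y_i and the moments, up to a power of the discriminant of the y_i; averaging
    over S_6 then leaves only symmetric functions of the y_i ([invariant_generation]). *)

Lemma fractionP (D : idomainType) (x : {fraction D}) :
  exists2 ab : D * D, ab.2 != 0 & x = ab.1%:F / ab.2%:F.
Proof.
exists (frac (generic_quotient.repr x)); first exact: denom_ratioP.
have d0 : (\d_(generic_quotient.repr x))%:F != 0 :> {fraction D}.
  by rewrite tofrac_eq0 denom_ratioP.
apply: (mulIf d0); rewrite mulfVK // {d0}; move: (generic_quotient.reprK x).
move: (generic_quotient.repr x) => r <-; unlock FracField.tofrac.
apply: (etrans (esym (FracField.pi_mul _ _))).
apply/generic_quotient.eqmodP; rewrite /= FracField.equivfE /FracField.mulf.
by rewrite !numden_Ratio ?mulf_neq0 ?oner_neq0 ?denom_ratioP // !mulr1 mulrC.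
Qed.

(** Sending z = f a / f b to a / b is well defined, since equality of two such presentations in K
    pulls back to D along the injective f. *)
Lemma fraction_field_iso (D : idomainType) (K : fieldType)
    (f : {rmorphism D -> K}) :
  injective f -> (forall z, exists a b : D, b != 0 /\ z * f b = f a) ->
  exists phi : {rmorphism K -> {fraction D}},
    bijective phi /\ forall d, phi (f d) = d%:F.
Proof.
move=> finj fgen.
have f0 b : b != 0 -> f b != 0.
  by move=> b0; rewrite -(rmorph0 f) (inj_eq finj).
have /choice[phi hphi] : forall z, exists x : {fraction D},
    exists a b : D, [/\ b != 0, z * f b = f a & x = a%:F / b%:F].
  by move=> z; have [a [b [b0 e]]] := fgen z; exists (a%:F / b%:F), a, b.
have phiE z a b : b != 0 -> z * f b = f a -> phi z = a%:F / b%:F.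
  move=> b0 e; have [a' [b' [b'0 e' ->]]] := hphi z.
  apply/eqP; rewrite eqr_div ?tofrac_eq0 // -!tofracM tofrac_eq.
  by apply/eqP/finj; rewrite !rmorphM -e -e' mulrAC.
have phif d : phi (f d) = d%:F.
  by rewrite (phiE _ d 1) ?oner_neq0 ?rmorph1 ?mulr1 ?divr1.
have phiB : zmod_morphism phi.
  move=> u v; have [a [b [b0 e eu]]] := hphi u; have [c [d [d0 e' ev]]] := hphi v.
  rewrite (phiE _ (a * d - c * b) (b * d)) ?mulf_neq0 //; last first.
    by rewrite rmorphB !rmorphM -e -e'; ring.
  rewrite eu ev -(mulNr c%:F) addf_div ?tofrac_eq0 //.
  by rewrite mulNr tofracB !tofracM.
have phiM : monoid_morphism phi.
  split; first by rewrite -(rmorph1 f) phif tofrac1.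
  move=> u v; have [a [b [b0 e eu]]] := hphi u; have [c [d [d0 e' ev]]] := hphi v.
  rewrite (phiE _ (a * c) (b * d)) ?mulf_neq0 //; last first.
    by rewrite !rmorphM -e -e'; ring.
  by rewrite eu ev mulf_div !tofracM.
pose phim : {rmorphism K -> {fraction D}} := HB.pack phi
  (GRing.isZmodMorphism.Build _ _ phi phiB)
  (GRing.isMonoidMorphism.Build _ _ phi phiM).
exists phim; split=> //.
have /choice[psi psiK] : forall x : {fraction D}, exists z, phi z = x.
  move=> x; have [[a b] /= b0 ->] := fractionP x; exists (f a / f b).
  by apply: phiE; rewrite // mulfVK // f0.
exists psi => [z|x]; last exact: psiK.
by apply: (fmorph_inj phim); rewrite /= psiK.
Qed.

Lemma tofrac_divD (D : idomainType) (a b c d : D) : b != 0 -> d != 0 ->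
  a%:F / b%:F + c%:F / d%:F = (a * d + c * b)%:F / (b * d)%:F.
Proof.
by move=> b0 d0; rewrite addf_div ?tofrac_eq0 // -!tofracM -tofracD.
Qed.

Lemma tofrac_divM (D : idomainType) (a b c d : D) :
  a%:F / b%:F * (c%:F / d%:F) = (a * c)%:F / (b * d)%:F.
Proof. by rewrite mulf_div -!tofracM. Qed.

Lemma tofrac_div_eq (D : idomainType) (a b c d : D) : b != 0 -> d != 0 ->
  a * d = c * b -> a%:F / b%:F = c%:F / d%:F.
Proof.
by move=> b0 d0 e; apply/eqP; rewrite eqr_div ?tofrac_eq0 // -!tofracM e.
Qed.

Section Criterion.
Variables (F : closedFieldType) (gT : finGroupType) (W : vectType F).
Variable X : gvariety gT W.

Definition is_form (d : nat) (f : W -> F) : Prop :=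
  exists2 P : {mpoly F[\dim {:W}]}, P \is d.-homog &
    forall w, f w = P.@[coords w].

Definition is_invariant (f : W -> F) : Prop :=
  forall g w, gv_pts X w -> f (gv_act X w g) = f w.

Lemma coord_of_eqP P Q :
  (forall w, gv_pts X w -> P.@[coords w] = Q.@[coords w]) ->
  coord_of X P = coord_of X Q.
Proof.
move=> e; apply/eqP; rewrite -subr_eq0 -rmorphB coord_of_eq0.
by apply/gv_idealP => w Xw; rewrite mevalB e // subrr.
Qed.

Fact git_const_zmod_morphism : zmod_morphism (@git_const _ _ _ X).
Proof.
move=> a b; apply: val_inj.
by rewrite /= !rmorphB.
Qed.
Fact git_const_monoid_morphism : monoid_morphism (@git_const _ _ _ X).
Proof.
split=> [|a b]; apply: val_inj.
  by rewrite /= !rmorph1.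
by rewrite /= !rmorphM.
Qed.
HB.instance Definition _ := GRing.isZmodMorphism.Build F (git_function_field X)
  (@git_const _ _ _ X) git_const_zmod_morphism.
HB.instance Definition _ := GRing.isMonoidMorphism.Build F (git_function_field X)
  (@git_const _ _ _ X) git_const_monoid_morphism.

Lemma val_gitM (z1 z2 : git_function_field X) : val (z1 * z2) = val z1 * val z2.
Proof. by []. Qed.

Variables (T : Type) (p : T -> W).
Hypothesis Xp : forall x, gv_pts X (p x).
Hypothesis dense_p : forall d f, is_form d f -> (forall x, f (p x) = 0) ->
  forall w, gv_pts X w -> f w = 0.

(* The rational function [z] restricts to [phi] along [p]. *)
Definition represents (z : git_function_field X) (phi : T -> F) : Prop :=
  exists d P Q, [/\ P \is d.-homog, Q \is d.-homog,
    is_invariant (fun w => P.@[coords w]) /\ is_invariant (fun w => Q.@[coords w]),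
    coord_of X Q != 0 /\ val z = (coord_of X P)%:F / (coord_of X Q)%:F &
    forall x, P.@[coords (p x)] = Q.@[coords (p x)] * phi x].

Lemma coord_of_eq_dense d P Q : P \is d.-homog -> Q \is d.-homog ->
  (forall x, P.@[coords (p x)] = Q.@[coords (p x)]) ->
  coord_of X P = coord_of X Q.
Proof.
move=> hP hQ e; apply: coord_of_eqP => w Xw; apply/eqP; rewrite -subr_eq0.
rewrite -mevalB; apply/eqP.
apply: (@dense_p d (fun w => (P - Q).@[coords w])) => // [|x].
  by exists (P - Q); rewrite ?rpredB.
by rewrite mevalB e subrr.
Qed.

Lemma represents_const c : represents (git_const X c) (fun=> c).
Proof.
exists 0%N, c%:MP, 1%:MP; split=> [||||x].
- by rewrite -[c%:MP]mulr1 mul_mpolyC rpredZ // dhomog1.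
- exact: dhomog1.
- by split=> g w _; rewrite !mevalC.
- by rewrite mpolyC1 rmorph1 oner_neq0 tofrac1 divr1.
- by rewrite !mevalC mul1r.
Qed.

Lemma representsD z1 z2 phi1 phi2 : represents z1 phi1 -> represents z2 phi2 ->
  represents (z1 + z2) (fun x => phi1 x + phi2 x).
Proof.
move=> [d [P [Q [hP hQ [iP iQ] [Q0 e1] e]]]].
move=> [d' [P' [Q' [hP' hQ' [iP' iQ'] [Q'0 e1'] e']]]].
exists (d + d')%N, (P * Q' + P' * Q), (Q * Q'); split.
- by apply: rpredD; [|rewrite addnC]; apply: dhomogM.
- exact: dhomogM.
- by split=> g w Xw; rewrite ?mevalD !mevalM ?iP ?iP' ?iQ ?iQ'.
- have -> : val (z1 + z2) = val z1 + val z2 by [].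
  rewrite (rmorphM (coord_of X) Q Q') e1 e1' (tofrac_divD _ _ Q0 Q'0).
  rewrite -(rmorphM (coord_of X) P Q') -(rmorphM (coord_of X) P' Q).
  rewrite -(rmorphD (coord_of X)); split; last exact: erefl.
  exact: (mulf_neq0 Q0 Q'0).
- by move=> x; rewrite mevalD !mevalM e e'; ring.
Qed.

Lemma representsM z1 z2 phi1 phi2 : represents z1 phi1 -> represents z2 phi2 ->
  represents (z1 * z2) (fun x => phi1 x * phi2 x).
Proof.
move=> [d [P [Q [hP hQ [iP iQ] [Q0 e1] e]]]].
move=> [d' [P' [Q' [hP' hQ' [iP' iQ'] [Q'0 e1'] e']]]].
exists (d + d')%N, (P * P'), (Q * Q'); split.
- exact: dhomogM.
- exact: dhomogM.
- by split=> g w Xw; rewrite !mevalM ?iP ?iP' ?iQ ?iQ'.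
- rewrite val_gitM (rmorphM (coord_of X) Q Q') e1 e1' tofrac_divM.
  rewrite -(rmorphM (coord_of X) P P'); split; last exact: erefl.
  exact: (mulf_neq0 Q0 Q'0).
- by move=> x; rewrite !mevalM e e'; ring.
Qed.

Variables (n : nat) (t : T -> 'I_n -> F).
Hypothesis numerators : forall i, exists d f h,
  [/\ is_form d f /\ is_form d h, is_invariant f, is_invariant h,
      exists x, h (p x) != 0 & forall x, f (p x) = h (p x) * t x i].
Hypothesis independent : forall d f (g : {mpoly F[n]}), is_form d f ->
  (exists x, f (p x) != 0) -> g != 0 -> exists2 x, f (p x) != 0 & g.@[t x] != 0.
Hypothesis generate : forall d f h, is_form d f -> is_form d h ->
  is_invariant f -> is_invariant h -> (exists x, h (p x) != 0) ->
  exists2 AB : {mpoly F[n]} * {mpoly F[n]}, exists x, AB.2.@[t x] != 0 &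
    forall x, f (p x) * AB.2.@[t x] = h (p x) * AB.1.@[t x].

Lemma coordinate_represented i : exists z, represents z (t^~ i).
Proof.
have [d [f [h [[[P hP eP] [Q hQ eQ]] iP iQ [x0 h0] e]]]] := numerators i.
have Q0 : coord_of X Q != 0.
  rewrite coord_of_eq0; apply: contra_neqN h0 => /gv_idealP hh.
  by rewrite eQ hh.
have iP' : is_invariant (fun w => P.@[coords w]).
  by move=> g w Xw; rewrite -!eP iP.
have iQ' : is_invariant (fun w => Q.@[coords w]).
  by move=> g w Xw; rewrite -!eQ iQ.
have hz : (coord_of X P)%:F / (coord_of X Q)%:F \in @git_fractions _ _ _ X.
  apply/asboolP; exists d, (coord_of X P), (coord_of X Q).
  by split=> //; [exists P | exists Q].
exists (SubfieldOf hz), d, P, Q; split=> // x.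
by rewrite -eP -eQ e.
Qed.

Lemma nonzero_on_slice d Q : Q \is d.-homog -> coord_of X Q != 0 ->
  exists x, Q.@[coords (p x)] != 0.
Proof.
move=> hQ; apply: contra_neqP => /forallNP h0.
rewrite -(rmorph0 (coord_of X)); apply: (coord_of_eq_dense hQ); first exact: rpred0.
by move=> x; rewrite meval0; apply/eqP/negPn/negP; apply: h0.
Qed.

(** Evaluation at representatives of the t_i maps the polynomial ring to the function field. It is
    injective by [independent], and by [generate] every element is a quotient of two values, so
    [fraction_field_iso] applies. *)
Lemma rational_by_coordinates : git_quotient_rational X.
Proof.
have /choice[tau htau] := coordinate_represented.
pose ev := mmap (@git_const _ _ _ X) tau : {mpoly F[n]} -> git_function_field X.
pose evm : {rmorphism {mpoly F[n]} -> git_function_field X} := ev.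
have evP g : represents (ev g) (fun x => g.@[t x]).
  elim/mpolyind: g => [|c m g _ _ IH].
    rewrite /ev mmap0 -(rmorph0 (@git_const _ _ _ X)).
    rewrite (_ : (fun x => _) = (fun=> 0)); first exact: represents_const.
    by apply/funext => x; rewrite meval0.
  rewrite /ev mmapD mmapZ mmapX; rewrite (_ : (fun x => _) =
    (fun x => c * \prod_(i < n) t x i ^+ m i + g.@[t x])); last first.
    by apply/funext => x; rewrite mevalD mevalZ mevalX.
  apply: representsD => //; apply: representsM; first exact: represents_const.
  rewrite /mmap1; elim: (index_enum _) => [|i s IHs].
    rewrite big_nil -(rmorph1 (@git_const _ _ _ X)).
    rewrite (_ : (fun x => _) = (fun=> 1)); first exact: represents_const.
    by apply/funext => x; rewrite big_nil.
  rewrite big_cons (_ : (fun x => _) =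
    (fun x => t x i ^+ m i * \prod_(j <- s) t x j ^+ m j)); last first.
    by apply/funext => x; rewrite big_cons.
  apply: representsM => //; elim: (m i) => [|k IHk].
    rewrite expr0 -(rmorph1 (@git_const _ _ _ X)); exact: represents_const.
  rewrite exprS (_ : (fun x => _) = (fun x => t x i * t x i ^+ k)).
    by apply: representsM.
  by apply/funext => x; rewrite exprS.
(* If g1 - g2 is sent to 0, the product of its denominator Q with (g1 - g2)(t x) vanishes for all x,
   while [independent] provides an x where neither factor does. *)
have evinj : injective evm.
  move=> g1 g2 /eqP; rewrite -subr_eq0 -rmorphB => /eqP e0.
  apply/eqP; rewrite -subr_eq0; apply/negPn/negP => g0.
  have [d [P [Q [hP hQ _ [Q0 e] ee]]]] := evP (g1 - g2).
  have hf : is_form d (fun w => Q.@[coords w]) by exists Q.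
  have [x hx /negP[]] := independent hf (nonzero_on_slice hQ Q0) g0.
  have /eqP : (coord_of X P)%:F / (coord_of X Q)%:F = 0.
    have e0' : ev (g1 - g2) = 0 := e0.
    by rewrite -e e0'.
  rewrite mulf_eq0 invr_eq0 !tofrac_eq0 (negPf Q0) orbF coord_of_eq0.
  move=> /gv_idealP /(_ (p x) (Xp x)); rewrite ee => /eqP.
  by rewrite mulf_eq0 (negPf hx).
have evgen z : exists a b, b != 0 /\ z * evm b = evm a.
  have /asboolP[d [f [h [[P [fP hP iP]] [Q [hQ' hQ iQ]] h0 ez]]]] :
    val z \in @git_fractions _ _ _ X by exact: valP.
  rewrite {}hQ' {}fP in h0 ez.
  have fP : is_form d (fun w => P.@[coords w]) by exists P.
  have fQ : is_form d (fun w => Q.@[coords w]) by exists Q.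
  have [[A B] /= [x0 B0] eAB] := generate fP fQ iP iQ (nonzero_on_slice hQ h0).
  exists A, B; split; first by apply: contra_neq B0 => ->; rewrite meval0.
  have [dA [PA [QA [hPA hQA _ [QA0 eA] eeA]]]] := evP A.
  have [dB [PB [QB [hPB hQB _ [QB0 eB] eeB]]]] := evP B.
  apply: val_inj; rewrite val_gitM ez eB eA tofrac_divM.
  apply: (tofrac_div_eq (mulf_neq0 h0 QB0) QA0).
  rewrite -(rmorphM (coord_of X) P PB).
  rewrite -(rmorphM (coord_of X) Q QB) -(rmorphM (coord_of X) _ QA).
  rewrite -(rmorphM (coord_of X) PA).
  apply: (@coord_of_eq_dense (d + dB + dA)%N).
  - by apply: dhomogM => //; apply: dhomogM.
  - by rewrite addnC; apply: dhomogM => //; apply: dhomogM.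
  move=> x; rewrite !mevalM eeA eeB.
  transitivity ((P.@[coords (p x)] * B.@[t x]) * (QB.@[coords (p x)] * QA.@[coords (p x)])).
    ring.
  rewrite eAB; ring.
have [phi [bij phiE]] := fraction_field_iso evinj evgen.
exists n, phi; split=> // c.
by rewrite -phiE; congr (phi _); rewrite /= /ev mmapC.
Qed.

End Criterion.

(** * Polynomial functions *)

Section FunctionAlgebra.
Variable F : closedFieldType.

(** The algebra of functions generated by the g i. As a predicate on functions it applies to
    parameter spaces of any type and is stable under substitution ([polyfun_comp]). *)
Inductive polyfun (T I : Type) (g : I -> T -> F) : (T -> F) -> Prop :=
| polyfun_const c : polyfun g (fun=> c)
| polyfun_gen i : polyfun g (g i)
| polyfunD f1 f2 : polyfun g f1 -> polyfun g f2 -> polyfun g (fun x => f1 x + f2 x)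
| polyfunM f1 f2 : polyfun g f1 -> polyfun g f2 -> polyfun g (fun x => f1 x * f2 x).

Section Closure.
Variables (T I : Type) (g : I -> T -> F).

Lemma polyfun_eq f1 f2 : polyfun g f1 -> f1 =1 f2 -> polyfun g f2.
Proof. by move=> h /funext <-. Qed.

Lemma polyfunZ c f : polyfun g f -> polyfun g (fun x => c * f x).
Proof. by move=> hf; apply: polyfunM => //; apply: polyfun_const. Qed.

Lemma polyfunN f : polyfun g f -> polyfun g (fun x => - f x).
Proof. by move=> hf; apply: polyfun_eq (polyfunZ (-1) hf) _ => x; rewrite mulN1r. Qed.

Lemma polyfunB f1 f2 : polyfun g f1 -> polyfun g f2 ->
  polyfun g (fun x => f1 x - f2 x).
Proof. by move=> h1 h2; apply: polyfunD => //; apply: polyfunN. Qed.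

Lemma polyfun_sum (J : Type) (s : seq J) (P : pred J) (f : J -> T -> F) :
  (forall j, P j -> polyfun g (f j)) -> polyfun g (fun x => \sum_(j <- s | P j) f j x).
Proof.
move=> hf; elim: s => [|j s IH].
  by apply: polyfun_eq (polyfun_const g 0) _ => x; rewrite big_nil.
have [Pj|nPj] := boolP (P j).
  apply: polyfun_eq (polyfunD (hf j Pj) IH) _ => x; rewrite big_cons Pj //.
by apply: polyfun_eq IH _ => x; rewrite big_cons (negPf nPj).
Qed.

Lemma polyfun_prod (J : Type) (s : seq J) (P : pred J) (f : J -> T -> F) :
  (forall j, P j -> polyfun g (f j)) -> polyfun g (fun x => \prod_(j <- s | P j) f j x).
Proof.
move=> hf; elim: s => [|j s IH].
  by apply: polyfun_eq (polyfun_const g 1) _ => x; rewrite big_nil.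
have [Pj|nPj] := boolP (P j).
  apply: polyfun_eq (polyfunM (hf j Pj) IH) _ => x; rewrite big_cons Pj //.
by apply: polyfun_eq IH _ => x; rewrite big_cons (negPf nPj).
Qed.

Lemma polyfunX f k : polyfun g f -> polyfun g (fun x => f x ^+ k).
Proof.
move=> hf; elim: k => [|k IH].
  by apply: polyfun_eq (polyfun_const g 1) _ => x; rewrite expr0.
by apply: polyfun_eq (polyfunM hf IH) _ => x; rewrite exprS.
Qed.

Lemma polyfun_meval n (P : {mpoly F[n]}) (v : T -> 'I_n -> F) :
  (forall i, polyfun g (v^~ i)) -> polyfun g (fun x => P.@[v x]).
Proof.
move=> hv; apply: (@polyfun_eq
  (fun x => \sum_(m <- msupp P) P@_m * \prod_i v x i ^+ m i)).
  apply: polyfun_sum => m _; apply: polyfunZ; apply: polyfun_prod => i _.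
  exact: polyfunX.
by move=> x; rewrite mevalE.
Qed.

Lemma polyfun_coef_prod (J : Type) (s : seq J) (P : pred J) (q : J -> T -> {poly F}) k :
  (forall j k, P j -> polyfun g (fun x => (q j x)`_k)) ->
  polyfun g (fun x => (\prod_(j <- s | P j) q j x)`_k).
Proof.
move=> hq; elim: s k => [|j s IH] k.
  by apply: polyfun_eq (polyfun_const g (1 : {poly F})`_k) _ => x; rewrite big_nil.
have [Pj|nPj] := boolP (P j); last first.
  by apply: polyfun_eq (IH k) _ => x; rewrite big_cons (negPf nPj).
apply: (@polyfun_eq (fun x => \sum_(i < k.+1) (q j x)`_i *
    (\prod_(j <- s | P j) q j x)`_(k - i))).
  by apply: polyfun_sum => i _; apply: polyfunM; [apply: hq | apply: IH].
by move=> x; rewrite big_cons Pj coefM.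
Qed.

End Closure.

Lemma polyfun_comp (T U I J : Type) (g : I -> T -> F) (h : J -> U -> F) (r : U -> T) f :
  polyfun g f -> (forall i, polyfun h (fun u => g i (r u))) ->
  polyfun h (fun u => f (r u)).
Proof.
move=> hf hg; elim: hf => {f} [c|i|f1 f2 _ IH1 _ IH2|f1 f2 _ IH1 _ IH2].
- exact: polyfun_const.
- exact: hg.
- exact: polyfunD.
- exact: polyfunM.
Qed.

Lemma polyfun_mpoly (T : Type) n (g : 'I_n -> T -> F) f : polyfun g f ->
  exists P : {mpoly F[n]}, forall x, f x = P.@[fun i => g i x].
Proof.
elim => {f} [c|i|f1 f2 _ [P1 e1] _ [P2 e2]|f1 f2 _ [P1 e1] _ [P2 e2]].
- by exists c%:MP => x; rewrite mevalC.
- by exists 'X_i => x; rewrite mevalXU.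
- by exists (P1 + P2) => x; rewrite mevalD e1 e2.
- by exists (P1 * P2) => x; rewrite mevalM e1 e2.
Qed.

Lemma polyfun_is_poly (f : F -> F) : polyfun (fun (_ : unit) t => t) f -> is_poly f.
Proof.
elim => {f} [c|i|f1 f2 _ [P1 e1] _ [P2 e2]|f1 f2 _ [P1 e1] _ [P2 e2]].
- by exists c%:P => x; rewrite hornerC.
- by exists 'X => x; rewrite hornerX.
- by exists (P1 + P2) => x; rewrite hornerD e1 e2.
- by exists (P1 * P2) => x; rewrite hornerM e1 e2.
Qed.

Lemma is_poly_neq0M (f1 f2 : F -> F) t1 t2 : is_poly f1 -> is_poly f2 ->
  f1 t1 != 0 -> f2 t2 != 0 -> exists t, f1 t != 0 /\ f2 t != 0.
Proof.
move=> [p1 e1] [p2 e2]; rewrite -e1 -e2 => h1 h2.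
have p10 : p1 != 0 by apply: contraNneq h1 => ->; rewrite horner0.
have p20 : p2 != 0 by apply: contraNneq h2 => ->; rewrite horner0.
have /closed_nonrootP[t] : p1 * p2 != 0 by rewrite mulf_neq0.
by rewrite rootM negb_or /root e1 e2 => /andP[]; exists t.
Qed.

(** On a polynomial curve through both points, f1 and f2 become non-zero polynomials in one
    variable, and their product has a non-root. *)
Lemma polyfun_neq0M (T I : Type) (g : I -> T -> F) f1 f2 x1 x2 (r : F -> T) :
  polyfun g f1 -> polyfun g f2 -> r 0 = x1 -> r 1 = x2 ->
  (forall i, polyfun (fun (_ : unit) t => t) (fun t => g i (r t))) ->
  f1 x1 != 0 -> f2 x2 != 0 -> exists t, f1 (r t) != 0 /\ f2 (r t) != 0.
Proof.
move=> hf1 hf2 <- <- hr h1 h2.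
apply: (@is_poly_neq0M (fun t => f1 (r t)) (fun t => f2 (r t)) 0 1) => //;
  apply: polyfun_is_poly; exact: polyfun_comp hr.
Qed.

Lemma meval_homog_scale n d (P : {mpoly F[n]}) c v : P \is d.-homog ->
  P.@[fun i => c * v i] = c ^+ d * P.@[v].
Proof.
move=> hP; rewrite !mevalE mulr_sumr !big_seq; apply: eq_bigr => m hm.
have <- : mdeg m = d by exact: (dhomog_mf hP).
rewrite mulrCA mdegE -prodrXr -big_split; congr (_ * _).
by apply: eq_bigr => i _; rewrite exprMn.
Qed.

(** Induction on the number of variables: [muni] views P as a polynomial in the last variable, one
    of whose coefficients is non-zero at some point v; over v only finitely many values of the last
    variable are roots. *)
Lemma mpoly_nonroot n (P : {mpoly F[n]}) : P != 0 -> exists v, P.@[v] != 0.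
Proof.
elim: n P => [|n IH] P P0.
  exists (fun=> 0); apply: contra_neq P0 => h.
  have [c e] : exists c, P = c%:MP.
    exists P@_0; apply/mpolyP => m; rewrite mcoeffC.
    have -> : m = 0%MM by apply/mnmP => -[].
    by rewrite eqxx mulr1.
  by rewrite e mevalC in h *; rewrite h mpolyC0.
have ext v t : (map_poly (meval v) (muni P)).[t] =
    P.@[fun i => oapp v t (unlift ord_max i)].
  rewrite muniE (mevalE _ P) rmorph_sum horner_sum; apply: eq_bigr => m _.
  rewrite -mul_polyC rmorphM /= map_polyC map_polyXn hornerM hornerC hornerXn /=.
  rewrite mevalZ mevalX big_ord_recr /= unlift_none /= -mulrA; congr (_ * (_ * _)).
  apply: eq_bigr => i _; rewrite mnmE.
  by have -> : unlift ord_max (widen_ord (leqnSn n) i) = Some i;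
    [rewrite (_ : widen_ord _ i = lift ord_max i) ?liftK //; apply: val_inj;
      rewrite /= /bump leqNgt ltn_ord | ].
have [k hk] : exists k, (muni P)`_k != 0.
  exists (mlead P ord_max); apply: contra_neq P0 => h; apply/eqP.
  rewrite -mleadc_eq0 -(mcoeff0 F [multinom mlead P (widen_ord (leqnSn n) i) | i < n]).
  rewrite -h muniE coef_sum raddf_sum /=; apply/eqP.
  have [->|P0] := eqVneq P 0; first by rewrite msupp0 big_nil mcoeff0.
  rewrite (bigD1_seq (mlead P)) ?msupp_uniq ?mlead_supp //= big1 => [|m hm].
    by rewrite coefZ coefXn eqxx mulr1 mcoeffZ mcoeffX eqxx mulr1 addr0.
  rewrite coefZ coefXn; case: eqP => [e|]; last by rewrite mulr0 mcoeff0.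
  rewrite mulr1 mcoeffZ mcoeffX; case: eqP => [e'|]; last by rewrite mulr0.
  case/eqP: hm; apply/mnmP => i; case: (unliftP ord_max i) => [j ->|-> //].
  have /mnmP/(_ j) := e'; rewrite !mnmE.
  rewrite (_ : widen_ord _ j = lift ord_max j) //; apply: val_inj.
  by rewrite /= /bump leqNgt ltn_ord.
have [v hv] := IH _ hk.
have /closed_nonrootP[t] : map_poly (meval v) (muni P) != 0.
  by apply: contra_neq hv => /(congr1 (fun q : {poly F} => q`_k)); rewrite coef_map coef0.
by rewrite /root ext => ht; exists (fun i => oapp v t (unlift ord_max i)).
Qed.

End FunctionAlgebra.

(** * Symmetric matrices and their moments *)

Section Moments.
Variable C : numClosedFieldType.
Implicit Types (a : 'I_6 -> 'I_6 -> C) (Y y : 'I_6 -> C) (u : 'I_9 -> C).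

Definition rowsum a (i : 'I_6) : C := \sum_j a i j.

Definition moment Y a (k l : nat) : C := \sum_i \sum_j a i j * (Y i ^+ k * Y j ^+ l).

Definition edge_matrix a := (forall i j, a i j = a j i) /\ (forall i, a i i = 0).

(* Exponents of the nine moments which, with the row sums, determine the     *)
(* matrix: [moment 0 l] depends on the row sums, and [moment 1 4] on the      *)
(* other ones by [moment14E].                                                 *)
Definition basic_pair (j : 'I_9) : nat * nat :=
  nth (0, 0)%N
    [:: (1, 1); (1, 2); (1, 3); (2, 2); (2, 3); (2, 4); (3, 3); (3, 4); (4, 4)]%N j.

Definition basic_index (k l : nat) : 'I_9 :=
  inord (index (minn k l, maxn k l)
    [:: (1, 1); (1, 2); (1, 3); (2, 2); (2, 3); (2, 4); (3, 3); (3, 4); (4, 4)]%N).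

Definition basic_moment Y a (j : 'I_9) : C :=
  moment Y a (basic_pair j).1 (basic_pair j).2.

Definition node_poly Y : {poly C} := \prod_i ('X - (Y i)%:P).

(** The nodes Y and the row sums y are kept apart, although they coincide in the end: for fixed Y
    the moments are linear in the matrix, which permits a dimension count. *)
Definition moment_of Y y u (k l : nat) : C :=
  if k == 0 then \sum_j y j * Y j ^+ l else
  if l == 0 then \sum_j y j * Y j ^+ k else u (basic_index k l).

(** The identity of [moment_relation] solved for L_14. Its top term is 2 L_05 + 2 L_14 + 2 L_23 by
    symmetry, and the other terms only contain L_kl with k + l <= 4. *)
Definition moment14 Y y u : C :=
  - (2^-1 * (2 * moment_of Y y u 0 5 + 2 * moment_of Y y u 2 3 +
     \sum_(k < 6) (node_poly Y)`_k * \sum_(t < k) moment_of Y y u (k.-1 - t) t)).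

Definition full_moment Y y u (k l : nat) : C :=
  if (minn k l == 1) && (maxn k l == 4) then moment14 Y y u else moment_of Y y u k l.

Lemma moment_sym Y a k l : edge_matrix a -> moment Y a k l = moment Y a l k.
Proof.
move=> [asym _]; rewrite /moment exchange_big; apply: eq_bigr => i _.
by apply: eq_bigr => j _; rewrite asym [_ ^+ k * _]mulrC.
Qed.

Lemma moment0 Y a l : edge_matrix a -> moment Y a 0 l = \sum_j rowsum a j * Y j ^+ l.
Proof.
move=> ha; rewrite moment_sym // /moment; apply: eq_bigr => i _.
by rewrite /rowsum mulr_suml; apply: eq_bigr => j _; rewrite expr0 mulr1.
Qed.

Lemma moment_ofE Y a k l : edge_matrix a ->
  (k == 0) || (l == 0) || [&& 0 < k <= 4, 0 < l <= 4,
     (k, l) != (1, 4) & (k, l) != (4, 1)]%N ->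
  moment Y a k l = moment_of Y (rowsum a) (basic_moment Y a) k l.
Proof.
move=> ha; rewrite /moment_of; have [->|k0] := eqVneq k 0; first by rewrite moment0.
have [->|l0] := eqVneq l 0; first by rewrite moment_sym // moment0.
case/and4P => /andP[_ hk] /andP[_ hl] n1 n2; rewrite /basic_moment.
have [ekl|ekl] : basic_pair (basic_index k l) = (k, l) \/
    basic_pair (basic_index k l) = (l, k); last 2 first.
- by rewrite ekl.
- by rewrite ekl moment_sym.
rewrite /basic_pair /basic_index.
by case: k k0 hk n1 n2 => [|[|[|[|[]]]]] // _ _;
  case: l l0 hl => [|[|[|[|[]]]]] // _ _ _ _; rewrite inordK //; first [by left | by right].
Qed.

(* [(F(x) - F(y)) / (x - y)] vanishes at distinct roots x, y of F. *)
Lemma moment_relation Y a : edge_matrix a -> injective Y ->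
  \sum_(k < 7) (node_poly Y)`_k * \sum_(t < k) moment Y a (k.-1 - t) t = 0.
Proof.
move=> [_ adiag] Yinj.
transitivity (\sum_i \sum_j a i j * \sum_(k < 7) (node_poly Y)`_k *
    \sum_(t < k) Y i ^+ (k.-1 - t) * Y j ^+ t).
  transitivity (\sum_(k < 7) \sum_i \sum_j a i j * ((node_poly Y)`_k *
      \sum_(t < k) Y i ^+ (k.-1 - t) * Y j ^+ t)).
    apply: eq_bigr => k _; rewrite /moment exchange_big mulr_sumr.
    apply: eq_bigr => i _; rewrite exchange_big mulr_sumr; apply: eq_bigr => j _.
    by rewrite -mulr_sumr mulrCA.
  rewrite exchange_big; apply: eq_bigr => i _; rewrite exchange_big.
  by apply: eq_bigr => j _; rewrite mulr_sumr.
apply: big1 => i _; apply: big1 => j _.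
have [->|ij] := eqVneq i j; first by rewrite adiag mul0r.
suff -> : \sum_(k < 7) (node_poly Y)`_k * \sum_(t < k) Y i ^+ (k.-1 - t) * Y j ^+ t = 0.
  by rewrite mulr0.
have d0 : Y i - Y j != 0 by rewrite subr_eq0 (inj_eq Yinj).
apply: (mulfI d0); rewrite mulr0 mulr_sumr.
have Y0 k : (node_poly Y).[Y k] = 0.
  rewrite /node_poly horner_prod (bigD1 k) //= hornerXsubC subrr mul0r //.
have size_node : (size (node_poly Y) <= 7)%N.
  by rewrite /node_poly size_prod_XsubC /index_enum -enumT size_enum_ord.
transitivity ((node_poly Y).[Y i] - (node_poly Y).[Y j]); last by rewrite !Y0 subrr.
rewrite !(horner_coef_wide _ size_node) -sumrB.
apply: eq_bigr => k _; rewrite mulrCA -mulrBr subrXX; congr (_ * (_ * _)).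
Qed.

Lemma moment14E Y a : edge_matrix a -> injective Y ->
  moment Y a 1 4 = moment14 Y (rowsum a) (basic_moment Y a).
Proof.
move=> ha Yinj; have := moment_relation ha Yinj; rewrite big_ord_recr /=.
have -> : (node_poly Y)`_6 = 1.
  have /monicP : node_poly Y \is monic by apply: monic_prod_XsubC.
  by rewrite /lead_coef /node_poly size_prod_XsubC /index_enum -enumT size_enum_ord.
rewrite mul1r (eq_bigr (fun k : 'I_6 => (node_poly Y)`_k *
    \sum_(t < k) moment_of Y (rowsum a) (basic_moment Y a) (k.-1 - t) t)).
  rewrite -(big_mkord xpredT (fun t => moment Y a (5 - t) t)).
  rewrite /index_iota /= !big_cons big_nil /= !subnE /=.
  rewrite (moment_sym _ 5 0 ha) (moment_sym _ 4 1 ha) (moment_sym _ 3 2 ha).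
  rewrite (@moment_ofE Y a 0 5) // (@moment_ofE Y a 2 3) // => h.
  rewrite /moment14.
  apply/eqP; rewrite -subr_eq0 opprK; apply/eqP.
  have n2 : 2 != 0 :> C by rewrite pnatr_eq0.
  apply: (mulfI n2); rewrite mulr0 -[RHS]h.
  rewrite mulrDr mulrA mulfV // mul1r.
  ring.
move=> k _; congr (_ * _); apply: eq_bigr => t _; apply: moment_ofE => //.
by case: k t => [[|[|[|[|[|[|k]]]]]] hk] // [[|[|[|[|[|t]]]]] ht].
Qed.

Lemma full_momentE Y a (k l : 'I_5) : edge_matrix a -> injective Y ->
  moment Y a k l = full_moment Y (rowsum a) (basic_moment Y a) k l.
Proof.
move=> ha Yinj; rewrite /full_moment; have := @moment_ofE Y a k l ha.
have h14 := moment14E ha Yinj.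
case: k l => [[|[|[|[|[|k]]]]] hk] // [[|[|[|[|[|l]]]]] hl] //= h;
  try exact: (h isT).
by rewrite moment_sym.
Qed.

Definition edge_poly Y (i j : 'I_6) : {poly C} :=
  \prod_(k | (k != i) && (k != j)) ('X - (Y k)%:P).

Definition separation Y (i j : 'I_6) : C := (edge_poly Y i j).[Y i] * (edge_poly Y i j).[Y j].

(** The eighth power of the discriminant of the six nodes: a symmetric function divisible by every
    [separation]. *)
Definition node_disc Y : C := \prod_i \prod_(j | j != i) separation Y i j.

Lemma edge_poly_root Y i j k : k != i -> k != j -> (edge_poly Y i j).[Y k] = 0.
Proof.
move=> ki kj; rewrite /edge_poly horner_prod (bigD1 k) /=; last by rewrite ki kj.
by rewrite hornerXsubC subrr mul0r.
Qed.

Lemma size_edge_poly Y i j : i != j -> size (edge_poly Y i j) = 5.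
Proof.
move=> ij; rewrite /edge_poly -big_filter size_prod_XsubC; congr _.+1.
rewrite (_ : [seq k <- _ | _] = enum [pred k | (k != i) && (k != j)]); last first.
  by rewrite /enum_mem; unlock index_enum; apply: eq_filter.
rewrite -cardE.
have := cardC (pred2 i j); rewrite card2 ij card_ord => /(canRL (addKn _)) e.
rewrite (@eq_card _ _ (predC (pred2 i j))) ?e // => k.
by rewrite !inE negb_or.
Qed.

(** The polynomial g = [edge_poly Y i j] has degree 4 and vanishes at all nodes but Y i and Y j. As
    the diagonal is zero, the sum of a p q g(Y p) g(Y q) keeps only the entries (i, j) and (j, i);
    expanding g gives moments with exponents at most 4. *)
Lemma lagrange_edge Y a i j : edge_matrix a -> injective Y -> i != j ->
  2 * a i j * separation Y i j = \sum_(k < 5) \sum_(l < 5)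
    (edge_poly Y i j)`_k * (edge_poly Y i j)`_l *
    full_moment Y (rowsum a) (basic_moment Y a) k l.
Proof.
move=> ha Yinj ij; have [asym adiag] := ha; set g := edge_poly Y i j.
have size_g : (size g <= 5)%N by rewrite size_edge_poly.
transitivity (\sum_p \sum_q a p q * (g.[Y p] * g.[Y q])).
  have g0 k : k != i -> k != j -> g.[Y k] = 0 by exact: edge_poly_root.
  rewrite (bigD1 i) // (bigD1 j) 1?eq_sym //= [X in _ = _ + (_ + X)]big1; last first.
    move=> k /andP[ki kj]; apply: big1 => l _.
    by rewrite g0 // mul0r mulr0.
  rewrite (bigD1 j) 1?eq_sym //= big1 ?addr0; last first.
    move=> k kj; have [->|ki] := eqVneq k i; first by rewrite adiag mul0r.
    by rewrite [g.[Y k]]g0 // !mulr0.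
  rewrite (bigD1 i) //= big1 ?addr0; last first.
    move=> k ki; have [->|kj] := eqVneq k j; first by rewrite adiag mul0r.
    by rewrite [g.[Y k]]g0 // !mulr0.
  by rewrite (asym j i) /separation; ring.
transitivity (\sum_p \sum_q \sum_(k < 5) \sum_(l < 5)
    a p q * (g`_k * Y p ^+ k * (g`_l * Y q ^+ l))).
  apply: eq_bigr => p _; apply: eq_bigr => q _.
  rewrite !(horner_coef_wide _ size_g) mulr_suml mulr_sumr; apply: eq_bigr => k _.
  by rewrite mulr_sumr mulr_sumr.
under eq_bigr do rewrite exchange_big.
rewrite exchange_big; apply: eq_bigr => k _.
transitivity (\sum_p \sum_(l < 5) \sum_q a p q * (g`_k * Y p ^+ k * (g`_l * Y q ^+ l))).
  by apply: eq_bigr => p _; rewrite exchange_big.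
rewrite exchange_big; apply: eq_bigr => l _.
rewrite -full_momentE // /moment mulr_sumr; apply: eq_bigr => p _.
by rewrite mulr_sumr; apply: eq_bigr => q _; ring.
Qed.

Lemma separation_neq0 Y i j : injective Y -> i != j -> separation Y i j != 0.
Proof.
move=> Yinj ij; rewrite /separation /edge_poly !horner_prod.
by apply: mulf_neq0; apply/prodf_neq0 => k /andP[ki kj];
  rewrite hornerXsubC subr_eq0 (inj_eq Yinj) eq_sym.
Qed.

Lemma edge_matrix_eq0 Y a : edge_matrix a -> injective Y ->
  rowsum a =1 (fun=> 0) -> basic_moment Y a =1 (fun=> 0) -> forall i j, a i j = 0.
Proof.
move=> ha Yinj /funext y0 /funext u0 i j.
have [<-|ij] := eqVneq i j; first by case: ha.
have := lagrange_edge ha Yinj ij; rewrite y0 u0.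
have of0 k l : moment_of Y (fun=> 0) (fun=> 0) k l = 0.
  rewrite /moment_of; case: ifP => _; first by apply: big1 => t _; rewrite mul0r.
  by case: ifP => _ //; apply: big1 => t _; rewrite mul0r.
have full0 k l : full_moment Y (fun=> 0) (fun=> 0) k l = 0.
  rewrite /full_moment /moment14 !of0 !mulr0 !add0r.
  rewrite big1 ?mulr0 ?oppr0 ?if_same // => t _.
  by rewrite big1 ?mulr0 // => t' _; rewrite of0.
rewrite big1 => [/eqP|k _]; last by apply: big1 => l _; rewrite full0 mulr0.
rewrite -mulrA mulf_eq0 pnatr_eq0 /= mulf_eq0 (negPf (separation_neq0 Yinj ij)) orbF.
by move/eqP.
Qed.

Lemma node_disc_neq0 Y : injective Y -> node_disc Y != 0.
Proof.
move=> Yinj; apply/prodf_neq0 => i _; apply/prodf_neq0 => j ji.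
by rewrite separation_neq0 // eq_sym.
Qed.

Lemma node_disc_inj Y : node_disc Y != 0 -> injective Y.
Proof.
move=> d0 i j; apply: contra_eq => ij; apply: contraNneq d0 => e.
(* For a third index k, the polynomial of the pair i, k vanishes at Y j = Y i, so the separation of
   i and k is zero. *)
have /existsP[k /andP[ki kj]] : [exists k : 'I_6, (k != i) && (k != j)].
  case: i j ij {e} => [[|[|[|i]]] hi] [[|[|[|j]]] hj] //= _; apply/existsP;
  first [by exists (inord 0); rewrite -!val_eqE /= inordK |
         by exists (inord 1); rewrite -!val_eqE /= inordK |
         by exists (inord 2); rewrite -!val_eqE /= inordK].
rewrite /node_disc (bigD1 i) //= (bigD1 k) //= /separation.
by rewrite e (@edge_poly_root Y i k j) 1?eq_sym // !mul0r.
Qed.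

Lemma node_disc_perm Y (s : 'S_6) : node_disc (Y \o s) = node_disc Y.
Proof.
rewrite /node_disc [RHS](reindex_inj (@perm_inj _ s)) /=; apply: eq_bigr => i _.
rewrite [RHS](reindex_inj (@perm_inj _ s)) /=.
apply: eq_big => [j|j _]; first by rewrite (inj_eq perm_inj).
rewrite /separation /= (_ : edge_poly (Y \o s) i j = edge_poly Y (s i) (s j)) //.
rewrite /edge_poly [RHS](reindex_inj (@perm_inj _ s)) /=.
by apply: eq_bigl => k; rewrite !(inj_eq perm_inj).
Qed.

End Moments.

Section NodePolyfun.
Variables (C : numClosedFieldType) (T I : Type) (g : I -> T -> C).
Variables (Y y : T -> 'I_6 -> C) (u : T -> 'I_9 -> C).
Hypothesis hY : forall i, polyfun g (fun x => Y x i).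
Hypothesis hy : forall i, polyfun g (fun x => y x i).
Hypothesis hu : forall i, polyfun g (fun x => u x i).

Lemma polyfun_moment_of k l : polyfun g (fun x => moment_of (Y x) (y x) (u x) k l).
Proof.
rewrite /moment_of; case: (k == 0).
  by apply: polyfun_sum => j _; apply: polyfunM => //; apply: polyfunX.
case: (l == 0) => //; by apply: polyfun_sum => j _; apply: polyfunM => //; apply: polyfunX.
Qed.

Lemma polyfun_coefXsubC i k : polyfun g (fun x => ('X - (Y x i)%:P)`_k).
Proof.
apply: (@polyfun_eq _ _ _ _ (fun x => (k == 1)%:R - (if k == 0 then Y x i else 0))).
  apply: polyfunB; first exact: polyfun_const.
  by case: (k == 0) => //; apply: polyfun_const.
by move=> x; rewrite coefB coefX coefC.
Qed.

Lemma polyfun_full_moment k l : polyfun g (fun x => full_moment (Y x) (y x) (u x) k l).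
Proof.
have h := polyfun_moment_of.
rewrite /full_moment; case: (_ && _) => //; rewrite /moment14.
apply/polyfunN/polyfunZ; do 2?apply: polyfunD; try exact: polyfunZ.
apply: polyfun_sum => i _; apply: polyfunM; last exact: polyfun_sum.
by apply: polyfun_coef_prod => *; apply: polyfun_coefXsubC.
Qed.

Lemma polyfun_coef_edge_poly i j k : polyfun g (fun x => (edge_poly (Y x) i j)`_k).
Proof. by apply: polyfun_coef_prod => *; apply: polyfun_coefXsubC. Qed.

Lemma polyfun_separation i j : polyfun g (fun x => separation (Y x) i j).
Proof.
apply: (@polyfun_eq _ _ _ _ (fun x => (\prod_(k | (k != i) && (k != j)) (Y x i - Y x k)) *
    \prod_(k | (k != i) && (k != j)) (Y x j - Y x k))).
  by apply: polyfunM; apply: polyfun_prod => k _; apply: polyfunB.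
move=> x; rewrite /separation /edge_poly !horner_prod.
by congr (_ * _); apply: eq_bigr => k _; rewrite hornerXsubC.
Qed.

Lemma polyfun_node_disc : polyfun g (fun x => node_disc (Y x)).
Proof.
by apply: polyfun_prod => i _; apply: polyfun_prod => j _; apply: polyfun_separation.
Qed.

End NodePolyfun.

(** * Invariants as polynomials in symmetric functions and moments *)

Section Generation.
Variables (C : numClosedFieldType) (k : nat).

Definition nodes_gen (J : Type) (n : nat) (i : 'I_n + J) (x : ('I_n -> C) * (J -> C)) : C :=
  match i with inl i => x.1 i | inr j => x.2 j end.

Lemma nodes_gen_left (J : Type) n i : polyfun (@nodes_gen J n) (fun x => x.1 i).
Proof. exact: (polyfun_gen _ (inl i)). Qed.

Lemma nodes_gen_right (J : Type) n i : polyfun (@nodes_gen J n) (fun x => x.2 i).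
Proof. exact: (polyfun_gen _ (inr i)). Qed.

Definition esyms (Y : 'I_6 -> C) (i : 'I_6) : C := (mesym 6 C i.+1).@[Y].

Lemma meval_msym n (P : {mpoly C[n]}) (s : 'S_n) v : (msym s P).@[v] = P.@[v \o s].
Proof.
rewrite /msym /mmap raddf_sum /= mevalE; apply: eq_bigr => m _.
rewrite mevalM mevalC rmorph_prod; congr (_ * _); apply: eq_bigr => i _.
by rewrite rmorphXn /= mevalXU.
Qed.

(** Separates the two groups of variables, so that symmetrization only affects the polynomials in
    the nodes. *)
Lemma polyfun_split (J : Type) n f : polyfun (@nodes_gen J n) f ->
  exists s : seq (((J -> C) -> C) * {mpoly C[n]}),
    (forall q, List.In q s -> polyfun (fun j (w : J -> C) => w j) q.1) /\
    forall x, f x = \sum_(q <- s) q.1 x.2 * q.2.@[x.1].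
Proof.
elim => {f} [c|[i|j]|f1 f2 _ [s1 [h1 e1]] _ [s2 [h2 e2]]
  |f1 f2 _ [s1 [h1 e1]] _ [s2 [h2 e2]]].
- exists [:: ((fun=> c), 1)]; split=> [q [<-|//]|x]; first exact: polyfun_const.
  by rewrite big_seq1 meval1 mulr1.
- exists [:: ((fun=> 1), 'X_i)]; split=> [q [<-|//]|x]; first exact: polyfun_const.
  by rewrite big_seq1 mevalXU mul1r.
- exists [:: ((fun w => w j), 1)]; split=> [q [<-|//]|x].
    exact: (polyfun_gen (fun j (w : J -> C) => w j) j).
  by rewrite big_seq1 meval1 mulr1.
- exists (s1 ++ s2); split=> [q /(@List.in_app_or _ s1 s2 q)[/h1|/h2] //|x].
  by rewrite big_cat e1 e2.
- exists [seq ((fun w => q1.1 w * q2.1 w), q1.2 * q2.2) | q1 <- s1, q2 <- s2]; split.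
    elim: s1 h1 {e1} => [|q1 s1 IH] h1 q //= /(@List.in_app_or _ _ _ q)[].
      elim: s2 h2 {e2 IH} => [|q2 s2 IH] h2 //= [<-|].
        by apply: polyfunM; [apply: h1; left | apply: h2; left].
      by apply: IH => q' hq'; apply: h2; right.
    by apply: IH => q' hq'; apply: h1; right.
  move=> x; rewrite e1 e2 big_allpairs_dep /= mulr_suml; apply: eq_bigr => q1 _.
  by rewrite mulr_sumr; apply: eq_bigr => q2 _; rewrite mevalM mulrACA.
Qed.

(** With w fixed, the fundamental theorem on symmetric polynomials applies to the sum of the
    conjugates of each node factor. *)
Lemma polyfun_symmetrize (J : Type) f : polyfun (@nodes_gen J 6) f ->
  exists2 h, polyfun (@nodes_gen J 6) h &
    forall Y w, \sum_(s : 'S_6) f (Y \o s, w) = h (esyms Y, w).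
Proof.
move=> /polyfun_split[sq [hsq e]].
elim: sq f hsq e => [|q sq IH] f hsq e.
  exists (fun=> 0); first exact: polyfun_const.
  by move=> Y w; rewrite big1 // => s _; rewrite e big_nil.
have [|h0 hh0 eh0] := IH (fun x => \sum_(q <- sq) q.1 x.2 * q.2.@[x.1]) _ (fun=> erefl).
  by move=> q' hq'; apply: hsq; right.
pose P := \sum_(s : 'S_6) msym s q.2.
have [|R [eR _]] := @sym_fundamental 6 C P.
  apply/issymP => s; rewrite /P raddf_sum /= [RHS](reindex_inj (@mulIg _ s)) /=.
  by apply: eq_bigr => s' _; rewrite msymMm.
exists (fun x => q.1 x.2 * R.@[x.1] + h0 x).
  apply: polyfunD => //; apply: polyfunM.
    apply: (polyfun_comp (r := snd) (hsq q (or_introl erefl))).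
    exact: nodes_gen_right.
  by apply: polyfun_meval => i; apply: nodes_gen_left.
move=> Y w; rewrite -eh0 /=.
have -> : R.@[esyms Y] = \sum_(s : 'S_6) q.2.@[Y \o s].
  transitivity P.@[Y]; last first.
    by rewrite /P raddf_sum /=; apply: eq_bigr => s _; rewrite meval_msym.
  by rewrite -eR comp_mpoly_meval; apply: meval_eq => i; rewrite tnth_mktuple.
rewrite mulr_sumr -big_split; apply: eq_bigr => s _.
by rewrite e big_cons.
Qed.

Variables (T : Type) (al : T -> 'I_6 -> 'I_6 -> C) (z : T -> 'I_k -> C).
Hypothesis edge_al : forall x, edge_matrix (al x).

Definition param_gen (i : ('I_6 * 'I_6) + 'I_k) (x : T) : C :=
  match i with inl p => al x p.1 p.2 | inr j => z x j end.

Definition nodes (x : T) : 'I_6 -> C := rowsum (al x).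

Definition tail_coord (x : T) (j : 'I_9 + 'I_k) : C :=
  match j with inl j => basic_moment (nodes x) (al x) j | inr j => z x j end.

(** An entry of the matrix is given by [lagrange_edge], whose denominator divides [node_disc]; sums
    and products add up the exponents. *)
Lemma clear_denominators f : polyfun param_gen f ->
  exists N, exists2 h, polyfun (@nodes_gen ('I_9 + 'I_k) 6) h &
    forall x, node_disc (nodes x) ^+ N * f x = h (nodes x, tail_coord x).
Proof.
have hd : polyfun (@nodes_gen ('I_9 + 'I_k) 6) (fun x => node_disc x.1).
  by apply: polyfun_node_disc => i; apply: nodes_gen_left.
elim => {f} [c|[[i j]|j]|f1 f2 _ [N1 [h1 hh1 e1]] _ [N2 [h2 hh2 e2]]
    |f1 f2 _ [N1 [h1 hh1 e1]] _ [N2 [h2 hh2 e2]]].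
- by exists 0, (fun=> c) => [|x]; [exact: polyfun_const | rewrite mul1r].
- have [<-|ij] := eqVneq i j.
    exists 0, (fun=> 0) => [|x]; first exact: polyfun_const.
    by rewrite /= (edge_al x).2 mulr0.
  exists 2.
  pose rest (Y : 'I_6 -> C) := (\prod_(l | (l != j) && (l != i)) separation Y i l) *
    \prod_(p | p != i) \prod_(l | l != p) separation Y p l.
  have discE Y : node_disc Y = separation Y i j * rest Y.
    rewrite /node_disc (bigD1 i) //= (bigD1 j) 1?eq_sym //= mulrA; congr (_ * _ * _).
    by apply: eq_bigl => l; rewrite andbC.
  pose lag (x : ('I_6 -> C) * ('I_9 + 'I_k -> C)) := \sum_(a < 5) \sum_(b < 5)
    (edge_poly x.1 i j)`_a * (edge_poly x.1 i j)`_b *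
    full_moment x.1 x.1 (fun l => x.2 (inl l)) a b.
  exists (fun x => node_disc x.1 * (2^-1 * (rest x.1 * lag x))).
    apply: polyfunM => //; apply: polyfunZ; apply: polyfunM.
      apply: polyfunM; first (apply: polyfun_prod => l _).
        by apply: polyfun_separation => p; apply: nodes_gen_left.
      apply: polyfun_prod => p _; apply: polyfun_prod => l _.
      by apply: polyfun_separation => q; apply: nodes_gen_left.
    apply: polyfun_sum => a _; apply: polyfun_sum => b _.
    apply: polyfunM; last first.
      by apply: polyfun_full_moment => p;
        first [exact: nodes_gen_left | exact: nodes_gen_right].
    by apply: polyfunM; apply: polyfun_coef_edge_poly => p; apply: nodes_gen_left.
  move=> x /=; have [d0|d0] := eqVneq (node_disc (nodes x)) 0.
    by rewrite d0 expr2 !mul0r.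
  have lagE := lagrange_edge (edge_al x) (node_disc_inj d0) ij.
  rewrite -/(nodes x) in lagE.
  rewrite /lag /= -[X in rest _ * X]lagE expr2 -mulrA; congr (_ * _).
  by rewrite discE; field; rewrite ?pnatr_eq0.
- exists 0; exists (fun x => x.2 (inr j)); first exact: nodes_gen_right.
  by move=> x; rewrite mul1r.
- exists (N1 + N2)%N, (fun x => node_disc x.1 ^+ N2 * h1 x + node_disc x.1 ^+ N1 * h2 x).
    by apply: polyfunD; apply: polyfunM => //; apply: polyfunX.
  by move=> x /=; rewrite -e1 -e2 exprD; ring.
- exists (N1 + N2)%N, (fun x => h1 x * h2 x); first exact: polyfunM.
  by move=> x; rewrite -e1 -e2 exprD; ring.
Qed.


Definition slice_point (J : Type) (Y : 'I_6 -> C) (w : J -> C) (i : 'I_5 + J) : C :=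
  match i with inl i => esyms Y (lift ord0 i) | inr j => w j end.

Definition slice_coord (x : T) := slice_point (nodes x) (tail_coord x).

Lemma esyms0 Y : \sum_i Y i = 1 -> esyms Y ord0 = 1.
Proof.
by move=> e; rewrite /esyms mesym1E raddf_sum -[RHS]e; apply: eq_bigr => i _; apply: mevalXU.
Qed.

(** Since f and [node_disc] are invariant, the cleared expression is the average of its conjugates
    under S_6, hence a polynomial in the e_i and the tail coordinates. The free n lets two functions
    be cleared by the same power. *)
Lemma invariant_generation f : polyfun param_gen f ->
  (forall (s : 'S_6) x, exists x', [/\ nodes x' = nodes x \o s,
    tail_coord x' = tail_coord x & f x' = f x]) ->
  exists N, forall n, exists2 h, polyfun (fun i (t : 'I_5 + ('I_9 + 'I_k) -> C) => t i) h &
    forall x, \sum_i nodes x i = 1 ->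
      node_disc (nodes x) ^+ (n + N) * f x = h (slice_coord x).
Proof.
move=> hf invf; have [N [h0' hh0' e0']] := clear_denominators hf.
exists N => n; pose h0 (x : ('I_6 -> C) * ('I_9 + 'I_k -> C)) := node_disc x.1 ^+ n * h0' x.
have hh0 : polyfun (@nodes_gen ('I_9 + 'I_k) 6) h0.
  apply: polyfunM => //; apply/polyfunX/polyfun_node_disc => i; exact: nodes_gen_left.
have e0 x : node_disc (nodes x) ^+ (n + N) * f x = h0 (nodes x, tail_coord x).
  by rewrite exprD -mulrA e0'.
have [h1 hh1 e1] := polyfun_symmetrize hh0.
(* On the slice e_1 = 1, so the missing first elementary symmetric function is restored as the
   constant 1. *)
pose ext (t : 'I_5 + ('I_9 + 'I_k) -> C) (i : 'I_6) :=
  if unlift ord0 i is Some j then t (inl j) else 1.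
have n0 : \sum_(s : 'S_6) 1 != 0 :> C.
  by rewrite sumr_const pnatr_eq0 -lt0n; apply/card_gt0P; exists 1%g.
exists (fun t => (\sum_(s : 'S_6) 1)^-1 * h1 (ext t, t \o inr)).
  apply: polyfunZ; apply: (polyfun_comp (r := fun t => (ext t, t \o inr)) hh1).
  move=> [i|j] /=; last exact: (polyfun_gen (fun i (t : _ -> C) => t i) (inr j)).
  rewrite /ext; case: unlift => [j|]; last exact: polyfun_const.
  exact: (polyfun_gen (fun i (t : _ -> C) => t i) (inl j)).
move=> x x1; have -> : ext (slice_coord x) = esyms (nodes x).
  apply/funext => i; rewrite /ext; case: unliftP => [j ->|->] //.
  by rewrite esyms0.
have -> : slice_coord x \o inr = tail_coord x by apply/funext.
suff -> : h1 (esyms (nodes x), tail_coord x) =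
    (\sum_(s : 'S_6) 1) * (node_disc (nodes x) ^+ (n + N) * f x) by rewrite mulKf.
rewrite -e1 mulr_suml; apply: eq_bigr => s _; rewrite mul1r.
have [x' [en et ef]] := invf s x.
by rewrite -en -et -e0 en ef node_disc_perm.
Qed.

(** The roots of the monic sextic with the prescribed coefficients. *)
Lemma esyms_surj (e : 'I_6 -> C) : exists Y, esyms Y = e.
Proof.
pose c (i : nat) : C := if i is i'.+1 then e (inord i') else 1.
pose p := \poly_(j < 7) ((-1) ^+ (6 - j)%N * c (6 - j)%N) : {poly C}.
have sz : size p = 7 by rewrite size_poly_eq //= mul1r oner_neq0.
have [r hr] := closed_field_poly_normal p.
have lp : lead_coef p = 1 by rewrite /lead_coef sz coef_poly /= mul1r.
rewrite lp scale1r in hr.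
have szr : size r == 6.
  by have := sz; rewrite hr size_prod_XsubC => -[->].
exists (tnth (Tuple szr)); apply/funext => i; rewrite /esyms.
have := @mroots_coeff _ 6 (Tuple szr) (lift ord0 i).
rewrite /= -hr coef_poly ltnS leq_subr => h.
apply: (@mulfI _ ((-1) ^+ i.+1)); first by rewrite signr_eq0.
rewrite -[LHS]h /=.
have -> : (6 - (6 - bump 0 i))%N = i.+1.
  by rewrite subKn // ; case: i {h} => i hi; rewrite /bump /= add1n.
by rewrite /= inord_val.
Qed.

(** Nodes with e_1 = 1 and the prescribed e_2, ..., e_6 exist but may collide; moving them along a
    line towards distinct nodes of sum 1 keeps the sum, and at some point of it G and the
    discriminant are both non-zero. *)
Lemma exists_nodes (J : Type) (G : ('I_5 + J -> C) -> C) t :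
  polyfun (fun i (t : 'I_5 + J -> C) => t i) G -> G t != 0 ->
  exists Y w, [/\ \sum_i Y i = 1, injective Y & G (slice_point Y w) != 0].
Proof.
move=> hG Gt.
have [Y eY] := esyms_surj (fun i => if unlift ord0 i is Some j then t (inl j) else 1).
have sY : \sum_i Y i = 1.
  have := congr1 (fun e => e ord0) eY; rewrite /esyms mesym1E raddf_sum unlift_none => <-.
  by apply: eq_bigr => i _; rewrite /= mevalXU.
have et : slice_point Y (t \o inr) = t.
  by apply/funext => -[i|j] //=; rewrite eY liftK.
(* Distinct nodes of sum 1, because 0 + 1 + ... + 5 = 15. *)
pose Y1 (i : 'I_6) : C := i%:R / 15%:R.
have n15 : 15%:R != 0 :> C by rewrite pnatr_eq0.
have sY1 : \sum_i Y1 i = 1.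
  by rewrite /Y1 -mulr_suml -natr_sum !big_ord_recl big_ord0 divff.
have injY1 : injective Y1.
  move=> i j /(mulIf (invr_neq0 n15)) /eqP; rewrite eqr_nat => /eqP; exact: val_inj.
pose r (s : C) := ((fun i => Y i + s * (Y1 i - Y i)), t \o inr).
have hd : polyfun (@nodes_gen J 6) (fun x => node_disc x.1).
  by apply: polyfun_node_disc => i; apply: nodes_gen_left.
have hG' : polyfun (@nodes_gen J 6) (fun x => G (slice_point x.1 x.2)).
  apply: (polyfun_comp (r := fun x => slice_point x.1 x.2) hG) => -[i|j].
    by apply: polyfun_meval => j; apply: nodes_gen_left.
  exact: nodes_gen_right.
have [|||s [h1 h2]] := @polyfun_neq0M _ _ _ _ _ _ (r 0) (r 1) r hG' hd erefl erefl.
- case=> [i|j] /=; last exact: polyfun_const.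
  apply: polyfunD; first exact: polyfun_const.
  apply: polyfunM; last exact: polyfun_const.
  exact: (polyfun_gen (fun (_ : unit) t => t) tt).
- rewrite /= (_ : (fun i => _) = Y) ?et //.
  by apply/funext => i; rewrite mul0r addr0.
- rewrite /= (_ : (fun i => _) = Y1) ?node_disc_neq0 //.
  by apply/funext => i; rewrite mul1r addrC subrK.
exists (r s).1, (r s).2; split=> //; last exact: node_disc_inj.
by rewrite /= big_split /= -mulr_sumr sumrB sY sY1; ring.
Qed.

End Generation.

(** * Quadrics on P^4 *)

Section Quadrics.
Variable C : numClosedFieldType.
Implicit Types (p : {mpoly C[5]}) (v w : 'I_6 -> C).

(** Only the first five coordinates are read; the sixth agrees with [zcoord] when v sums to zero. *)
Definition zeval p v : C := p.@[fun j => v (lift ord_max j)].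

Lemma zeval_zcoord v i : \sum_j v j = 0 -> zeval (zcoord C i) v = v i.
Proof.
move=> v0; case: (unliftP ord_max i) => [j ->|->].
  by rewrite zcoord_lift /zeval mevalXU.
rewrite zcoord_max /zeval mevalN (raddf_sum (meval _)) /=.
apply/eqP; rewrite eq_sym -subr_eq0 opprK.
apply/eqP.
rewrite -[RHS]v0 [in RHS]big_ord_recr /= addrC; congr (_ + _).
apply: eq_bigr => j _; rewrite mevalXU; congr v; apply: val_inj.
by rewrite /= /bump leqNgt ltn_ord.
Qed.

Lemma zeval_permute s p v : \sum_j v j = 0 -> zeval (permute_z s p) v = zeval p (v \o s).
Proof.
move=> v0; rewrite /zeval /permute_z comp_mpoly_meval; apply: meval_eq => j.
by rewrite tnth_mktuple -/(zeval _ v) zeval_zcoord.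
Qed.

Definition dvec (i j l : 'I_6) : C := (l == i)%:R - (l == j)%:R.

Lemma sum_delta (f : 'I_6 -> C) i : \sum_l (l == i)%:R * f l = f i.
Proof.
rewrite (bigD1 i) //= eqxx mul1r big1 ?addr0 // => l /negPf ->.
by rewrite mul0r.
Qed.

Lemma sum_dvec i j : \sum_l dvec i j l = 0.
Proof.
have e k : \sum_(l : 'I_6) (l == k)%:R = 1 :> C.
  by rewrite -[RHS](sum_delta (fun=> 1) k); apply: eq_bigr => l _; rewrite mulr1.
by rewrite /dvec sumrB !e subrr.
Qed.

(* The coefficients of a quadric in the basis [z_i z_j], i < j: on the point  *)
(* [dvec i j], all these products vanish except [z_i z_j = -1].               *)
Definition qcoef p (i j : 'I_6) : C := - zeval p (dvec i j).

Lemma qcoef_permute s p i j :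
  qcoef (permute_z s p) i j = qcoef p (s^-1%g i) (s^-1%g j).
Proof.
rewrite /qcoef zeval_permute ?sum_dvec //; congr (- zeval _ _).
by apply/funext => l; rewrite /dvec /= !(canF_eq (permK s)).
Qed.

Lemma quadric_monomial (m : 'X_{1..5}) : mdeg m = 2 ->
  exists i j, 'X_[m] = zcoord C i * zcoord C j.
Proof.
move=> hm; have [i mi] : exists i, m i != 0%N.
  apply/existsP; apply: contraT; rewrite negb_exists => /forallP m0.
  suff : mdeg m = 0%N by rewrite hm.
  by rewrite mdegE; apply: big1 => i _; apply/eqP/negPn/m0.
have hle : (U_(i) <= m)%MM.
  by apply/mnm_lepP => l; rewrite mnm1E; case: eqP => // <-; rewrite lt0n.
have /eqP/mdeg1P[j /eqP ej] : mdeg (m - U_(i))%MM = 1%N.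
  apply: (@addnI 1%N); rewrite -{1}(mdeg1 i) -mdegD addmC submK //.
exists (lift ord_max i), (lift ord_max j).
by rewrite !zcoord_lift -mpolyXD -ej addmC submK.
Qed.

Lemma qcoef_zcoordM k l i j : qcoef (zcoord C k * zcoord C l) i j =
  - (((k == i)%:R - (k == j)%:R) * ((l == i)%:R - (l == j)%:R)).
Proof.
rewrite /qcoef /zeval mevalM -!/(zeval _ (dvec i j)).
by rewrite !zeval_zcoord ?sum_dvec.
Qed.

(** On expanding, every term with a factor \sum_i z i drops. For indicator vectors A and B the
    coefficients are those of [qcoef_zcoordM], which yields the expansion of a product z_k z_l. *)
Lemma sum_difference_form (R : comNzRingType) (n : nat) (A B z : 'I_n -> R) :
  \sum_i z i = 0 ->
  \sum_i \sum_j - ((A i - A j) * (B i - B j)) * (z i * z j) =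
  2 * ((\sum_i A i * z i) * (\sum_j B j * z j)).
Proof.
move=> z0.
transitivity (\sum_i (A i * z i * (\sum_j B j * z j) + B i * z i * (\sum_j A j * z j)
   - A i * B i * z i * (\sum_j z j) - z i * (\sum_j A j * B j * z j))).
  apply: eq_bigr => i _; rewrite !mulr_sumr -big_split -!sumrB.
  by apply: eq_bigr => j _ /=; ring.
rewrite z0 !sumrB big_split /= -!mulr_suml z0; ring.
Qed.

Lemma zcoordM_qcoef k l : \sum_i \sum_j
  qcoef (zcoord C k * zcoord C l) i j *: (zcoord C i * zcoord C j) =
  2 *: (zcoord C k * zcoord C l).
Proof.
have D (i : 'I_6) : \sum_j ((i == j)%:R : C)%:MP * zcoord C j = zcoord C i.
  rewrite (bigD1 i) //= eqxx mpolyC1 mul1r big1 ?addr0 // => j.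
  by rewrite eq_sym => /negPf ->; rewrite mpolyC0 mul0r.
have := sum_difference_form (fun i => ((k == i)%:R : C)%:MP)
  (fun i => ((l == i)%:R : C)%:MP) (sum_zcoord C).
rewrite !D -mul_mpolyC rmorph_nat => <-.
apply: eq_bigr => i _; apply: eq_bigr => j _.
by rewrite qcoef_zcoordM -mul_mpolyC rmorphN rmorphM !rmorphB.
Qed.

(** By linearity it suffices to treat the monomials, which are products z_k z_l. The factor 1/2
    corrects for each pair being counted twice. *)
Lemma quadric_expansion (q : quadric_form C) : (q : {mpoly C[5]}) =
  2^-1 *: \sum_i \sum_j qcoef q i j *: (zcoord C i * zcoord C j).
Proof.
have n2 : 2 != 0 :> C by rewrite pnatr_eq0.
apply: (scalerI n2); rewrite scalerA mulfV // scale1r.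
have hq := dhomog_is_dhomog q.
rewrite [in LHS](mpolyE q) scaler_sumr.
transitivity (\sum_(m <- msupp q) \sum_i \sum_j
    (q : {mpoly C[5]})@_m *: (qcoef 'X_[m] i j *: (zcoord C i * zcoord C j))).
  rewrite !big_seq; apply: eq_bigr => m hm; rewrite scalerA mulrC -scalerA.
  have [k [l ->]] := quadric_monomial (dhomog_mf hq hm).
  by rewrite -zcoordM_qcoef scaler_sumr; apply: eq_bigr => i _; rewrite scaler_sumr.
rewrite exchange_big; apply: eq_bigr => i _; rewrite exchange_big; apply: eq_bigr => j _.
have -> : qcoef q i j = \sum_(m <- msupp q) (q : {mpoly C[5]})@_m * qcoef 'X_[m] i j.
  rewrite /qcoef /zeval mevalE -sumrN; apply: eq_bigr => m _.
  by rewrite mevalX mulrN.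
by rewrite scaler_suml; apply: eq_bigr => m _; rewrite scalerA.
Qed.

Lemma zeval_scale d p c v : p \is d.-homog -> zeval p (fun i => c * v i) = c ^+ d * zeval p v.
Proof. exact: meval_homog_scale. Qed.

Lemma quadric_edge_matrix (q : quadric_form C) : edge_matrix (qcoef q).
Proof.
have hq := dhomog_is_dhomog q; split=> [i j|i].
  rewrite /qcoef; congr (- _); transitivity ((-1) ^+ 2 * zeval q (dvec i j)).
    by rewrite sqrrN expr1n mul1r.
  by rewrite -(zeval_scale _ _ hq); congr zeval; apply/funext => l; rewrite /dvec; ring.
rewrite /qcoef (_ : dvec i i = (fun l => 0 * 0)).
  by rewrite (zeval_scale _ (fun=> 0) hq) expr0n mul0r oppr0.
by apply/funext => l; rewrite /dvec subrr mulr0.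
Qed.

Lemma qcoef_eq0 (q : quadric_form C) : (forall i j, qcoef q i j = 0) -> q = 0.
Proof.
move=> q0; apply: val_inj; rewrite /= (quadric_expansion q).
by rewrite big1 ?scaler0 // => i _; apply: big1 => j _; rewrite q0 scale0r.
Qed.

Lemma qcoef_linear (c : C) (q r : quadric_form C) i j :
  qcoef (c *: q + r : quadric_form C) i j = c * qcoef q i j + qcoef r i j.
Proof. by rewrite /qcoef /zeval /= mevalD mevalZ; ring. Qed.

Definition edge_data (Y : 'I_6 -> C) (q : quadric_form C) : 'rV[C]_(6 + 9) :=
  row_mx (\row_i rowsum (qcoef q) i) (\row_j basic_moment Y (qcoef q) j).

Fact edge_data_is_linear Y : linear (edge_data Y).
Proof.
move=> c q r; rewrite /edge_data scale_row_mx add_row_mx; congr row_mx; apply/rowP => i.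
  rewrite !mxE /rowsum mulr_sumr -big_split; apply: eq_bigr => j _.
  exact: qcoef_linear.
rewrite !mxE /basic_moment /moment mulr_sumr -big_split; apply: eq_bigr => j _.
rewrite mulr_sumr -big_split; apply: eq_bigr => l _ /=.
by rewrite qcoef_linear; ring.
Qed.

HB.instance Definition _ Y := GRing.isLinear.Build C (quadric_form C) 'rV[C]_(6 + 9) _
  (edge_data Y) (edge_data_is_linear Y).

(* [edge_data Y] is an injective linear map between spaces of dimension 15.  *)
Lemma quadric_of_data Y (y : 'I_6 -> C) (u : 'I_9 -> C) : injective Y ->
  exists q : quadric_form C, rowsum (qcoef q) = y /\ basic_moment Y (qcoef q) = u.
Proof.
move=> Yinj.
have ker0 : lker (linfun (edge_data Y)) = 0%VS.
  apply/eqP; rewrite -subv0; apply/subvP => q; rewrite memv_ker lfunE /= => /eqP e.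
  rewrite memv0; apply/eqP/qcoef_eq0.
  have e' : row_mx (\row_i rowsum (qcoef q) i) (\row_j basic_moment Y (qcoef q) j) =
    row_mx (0 : 'rV[C]_6) (0 : 'rV[C]_9) by rewrite row_mx0.
  have [/rowP e1 /rowP e2] := eq_row_mx e'.
  apply: (edge_matrix_eq0 (quadric_edge_matrix q) Yinj) => i.
    by have := e1 i; rewrite !mxE.
  by have := e2 i; rewrite !mxE.
have : (row_mx (\row_i y i) (\row_j u j)) \in limg (linfun (edge_data Y)).
  suff -> : limg (linfun (edge_data Y)) = fullv by rewrite memvf.
  apply/eqP; rewrite eqEdim subvf /=.
  have := limg_ker_dim (linfun (edge_data Y)) fullv.
  rewrite ker0 capv0 dimv0 add0n => ->.
  by rewrite !dimvf.
case/memv_imgP => q _; rewrite lfunE /= => e; exists q.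
have [/rowP e1 /rowP e2] := eq_row_mx e.
split; apply/funext => i; first by have := e1 i; rewrite !mxE.
by have := e2 i; rewrite !mxE.
Qed.

End Quadrics.

(** * Forms *)

Section Forms.
Variables (F : closedFieldType) (W : vectType F).

Lemma is_form_cast d e (f g : W -> F) : is_form d f -> d = e -> f =1 g -> is_form e g.
Proof. by move=> hf <- /funext <-. Qed.

Lemma is_form_const c : is_form 0 (fun _ : W => c).
Proof.
exists c%:MP => [|w]; last by rewrite mevalC.
by rewrite -[c%:MP]mulr1 mul_mpolyC rpredZ // dhomog1.
Qed.

Lemma is_form0 d : is_form d (fun _ : W => 0).
Proof. by exists 0 => [|w]; rewrite ?rpred0 ?meval0. Qed.

Lemma is_formD d (f g : W -> F) : is_form d f -> is_form d g -> is_form d (fun w => f w + g w).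
Proof.
by move=> [P hP eP] [Q hQ eQ]; exists (P + Q) => [|w]; rewrite ?rpredD // mevalD eP eQ.
Qed.

Lemma is_formM d e (f g : W -> F) :
  is_form d f -> is_form e g -> is_form (d + e) (fun w => f w * g w).
Proof.
move=> [P hP eP] [Q hQ eQ]; exists (P * Q) => [|w]; first exact: dhomogM.
by rewrite mevalM eP eQ.
Qed.

Lemma is_formZ d c (f : W -> F) : is_form d f -> is_form d (fun w => c * f w).
Proof. exact: is_formM (is_form_const c). Qed.

Lemma is_formN d (f : W -> F) : is_form d f -> is_form d (fun w => - f w).
Proof. by move=> /(is_formZ (-1)) hf; apply: is_form_cast hf _ _ => // w; rewrite mulN1r. Qed.

Lemma is_formB d (f g : W -> F) : is_form d f -> is_form d g -> is_form d (fun w => f w - g w).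
Proof. by move=> hf hg; apply: is_formD => //; apply: is_formN. Qed.

Lemma is_form_sum d (J : Type) (s : seq J) (f : J -> W -> F) :
  (forall j, is_form d (f j)) -> is_form d (fun w => \sum_(j <- s) f j w).
Proof.
move=> hf; elim: s => [|j s IH].
  by apply: is_form_cast (is_form0 d) _ _ => // w; rewrite big_nil.
by apply: is_form_cast (is_formD (hf j) IH) _ _ => // w; rewrite big_cons.
Qed.

Lemma is_form_prod (J : Type) (s : seq J) (d : J -> nat) (f : J -> W -> F) :
  (forall j, is_form (d j) (f j)) ->
  is_form (\sum_(j <- s) d j)%N (fun w => \prod_(j <- s) f j w).
Proof.
move=> hf; elim: s => [|j s IH].
  by apply: is_form_cast (is_form_const 1) _ _ => [|w]; rewrite big_nil.
by apply: is_form_cast (is_formM (hf j) IH) _ _ => [|w]; rewrite big_cons.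
Qed.

Lemma is_formX d k (f : W -> F) : is_form d f -> is_form (d * k) (fun w => f w ^+ k).
Proof.
move=> hf; apply: is_form_cast (is_form_prod (iota 0 k) (fun=> hf)) _ _ => [|w].
  by rewrite big_const_seq count_predT size_iota iter_addn_0.
by rewrite big_const_seq count_predT size_iota -Monoid.iteropE.
Qed.

Lemma is_form_meval n (P : {mpoly F[n]}) d e (v : W -> 'I_n -> F) : P \is d.-homog ->
  (forall i, is_form e (v^~ i)) -> is_form (e * d) (fun w => P.@[v w]).
Proof.
move=> hP hv; pose G (m : 'X_{1..n}) (w : W) :=
  if m \in msupp P then P@_m * \prod_(i <- index_enum 'I_n) v w i ^+ m i else 0.
apply: is_form_cast (is_form_sum (f := G) (d := e * d) (msupp P) _) _ _ => // [m|w].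
  rewrite /G; have [hm|_] := boolP (m \in msupp P); last exact: is_form0.
  have <- : mdeg m = d by exact: (dhomog_mf hP).
  rewrite mdegE big_distrr; apply/is_formZ/is_form_prod => i; exact: is_formX.
by rewrite mevalE !big_seq; apply: eq_bigr => m hm; rewrite /G hm.
Qed.

Lemma is_form_linear (f : W -> F) : (forall c u v, f (c *: u + v) = c * f u + f v) ->
  is_form 1 f.
Proof.
move=> lf; have f0 : f 0 = 0.
  have := lf 1 0 0; rewrite scaler0 addr0 mul1r => /eqP.
  by rewrite -subr_eq0 opprD addrA subrr sub0r oppr_eq0 => /eqP.
have fsum n (c : 'I_n -> F) (b : 'I_n -> W) : f (\sum_i c i *: b i) = \sum_i c i * f (b i).
  elim: n c b => [|n IH] c b; first by rewrite !big_ord0.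
  by rewrite !big_ord_recl lf IH.
exists (\sum_(i < \dim {:W}) f (vbasis {:W})`_i *: 'X_i).
  by rewrite rpred_sum // => i _; rewrite rpredZ // dhomogX /= mdeg1.
move=> w; rewrite {1}(coord_vbasis (memvf w)) fsum raddf_sum; apply: eq_bigr => i _.
by rewrite /= mevalZ mevalXU mulrC.
Qed.

Lemma is_form_scale d (f : W -> F) c w : is_form d f -> f (c *: w) = c ^+ d * f w.
Proof.
move=> [P hP eP]; rewrite !eP -(meval_homog_scale _ _ hP); apply: meval_eq => i.
by rewrite /coords linearZ.
Qed.

Lemma is_form_act (gT : finGroupType) (X : gvariety gT W) d (f : W -> F) g :
  is_form d f -> is_form d (fun w => f (gv_act X w g)).
Proof.
move=> [P hP eP]; rewrite -[d]mul1n.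
apply: is_form_cast (is_form_meval (e := 1) (v := fun w => coords (gv_act X w g)) hP _) _ _ => //.
move=> i; apply: is_form_linear => c u v; rewrite /coords.
by rewrite (gv_linear X g c u v) linearP.
Qed.

End Forms.

(** * Recovering a quadric from a quartic of its Igusa pencil *)

Section Recovery.
Variable C : numClosedFieldType.
Implicit Types (p : {mpoly C[5]}) (v w : 'I_6 -> C) (q : quadric_form C).

Definition line_poly v w p : {poly C} :=
  mmap (@polyC C) (fun j : 'I_5 => (v (lift ord_max j))%:P + (w (lift ord_max j))%:P * 'X) p.

HB.instance Definition _ v w := GRing.RMorphism.copy (line_poly v w)
  (mmap (@polyC C)
    (fun j : 'I_5 => (v (lift ord_max j))%:P + (w (lift ord_max j))%:P * 'X)).

Lemma line_poly_zcoord v w i : \sum_j v j = 0 -> \sum_j w j = 0 ->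
  line_poly v w (zcoord C i) = (v i)%:P + (w i)%:P * 'X.
Proof.
move=> v0 w0; have X j : line_poly v w 'X_j =
    (v (lift ord_max j))%:P + (w (lift ord_max j))%:P * 'X.
  by rewrite /line_poly mmapX mmap1U.
case: (unliftP ord_max i) => [j ->|->]; first by rewrite zcoord_lift X.
rewrite zcoord_max rmorphN rmorph_sum /=; apply/eqP; rewrite eq_sym -subr_eq0 opprK.
apply/eqP; transitivity (\sum_(i < 6) ((v i)%:P + (w i)%:P * 'X)); last first.
  by rewrite big_split /= -mulr_suml -!rmorph_sum /= v0 w0 mul0r addr0.
rewrite [RHS]big_ord_recr /= addrC; congr (_ + _).
apply: eq_bigr => j _; rewrite X (_ : widen_ord _ j = lift ord_max j) //.
by apply: val_inj; rewrite /= /bump leqNgt ltn_ord.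
Qed.

Lemma line_polyZ v w c p : line_poly v w (c *: p) = c%:P * line_poly v w p.
Proof. exact: mmapZ. Qed.

(** The polar form q(v + w) - q(v) - q(w), which is the coefficient of t in q(v + t w). *)
Definition qmid q v w : C :=
  2^-1 * \sum_i \sum_j qcoef q i j * (v i * w j + w i * v j).

Lemma zeval_quadric q v : \sum_j v j = 0 ->
  zeval q v = 2^-1 * \sum_i \sum_j qcoef q i j * (v i * v j).
Proof.
move=> v0; rewrite [in LHS](quadric_expansion q) /zeval mevalZ (raddf_sum (meval _)) /=.
congr (_ * _); apply: eq_bigr => i _; rewrite (raddf_sum (meval _)) /=.
apply: eq_bigr => j _; rewrite mevalZ mevalM -!/(zeval _ v).
by rewrite !zeval_zcoord.
Qed.

Lemma line_poly_quadric q v w : \sum_j v j = 0 -> \sum_j w j = 0 ->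
  line_poly v w q =
  (zeval q v)%:P + (qmid q v w)%:P * 'X + (zeval q w)%:P * 'X^2.
Proof.
move=> v0 w0; rewrite [in LHS](quadric_expansion q) line_polyZ rmorph_sum /=.
rewrite !zeval_quadric // /qmid !rmorphM -!mulrA -!mulrDr; congr (_ * _).
rewrite !rmorph_sum /= !mulr_suml -!big_split; apply: eq_bigr => i _ /=.
rewrite !rmorph_sum /= !mulr_suml -!big_split; apply: eq_bigr => j _ /=.
rewrite line_polyZ rmorphM /= !line_poly_zcoord //.
rewrite !(rmorphM, rmorphD) /=; ring.
Qed.

Lemma coef_truncation (c0 c1 c2 : C) (r : {poly C}) :
  let P := c0%:P + c1%:P * 'X + c2%:P * 'X^2 + r * 'X^3 in
  [/\ P`_0 = c0, P`_1 = c1 & P`_2 = c2].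
Proof.
by split; rewrite !coefD !coefCM coefC coefX coefXn coefMXn /=; ring.
Qed.

Lemma coef_square (a0 a1 a2 : C) :
  let P := (a0%:P + a1%:P * 'X + a2%:P * 'X^2) ^+ 2 in
  [/\ P`_0 = a0 ^+ 2, P`_1 = 2 * a0 * a1 & P`_2 = a1 ^+ 2 + 2 * a0 * a2].
Proof.
rewrite /=; have -> : (a0%:P + a1%:P * 'X + a2%:P * 'X^2) ^+ 2 =
  (a0 ^+ 2)%:P + (2 * a0 * a1)%:P * 'X + (a1 ^+ 2 + 2 * a0 * a2)%:P * 'X^2 +
  ((2 * a1 * a2)%:P + (a2 ^+ 2)%:P * 'X) * 'X^3.
  by rewrite !(rmorphM, rmorphD, rmorphXn, rmorph_nat) /=; ring.
exact: coef_truncation.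
Qed.

Lemma coef_linear_pow4 (a b : C) :
  let P := (a%:P + b%:P * 'X) ^+ 4 in
  [/\ P`_0 = a ^+ 4, P`_1 = 4 * a ^+ 3 * b & P`_2 = 6 * a ^+ 2 * b ^+ 2].
Proof.
rewrite /=; have -> : (a%:P + b%:P * 'X) ^+ 4 =
  (a ^+ 4)%:P + (4 * a ^+ 3 * b)%:P * 'X + (6 * a ^+ 2 * b ^+ 2)%:P * 'X^2 +
  ((4 * a * b ^+ 3)%:P + (b ^+ 4)%:P * 'X) * 'X^3.
  by rewrite !(rmorphM, rmorphD, rmorphXn, rmorph_nat) /=; ring.
exact: coef_truncation.
Qed.

Lemma line_poly_igusa v w : \sum_j v j = 0 -> \sum_j w j = 0 ->
  let P := line_poly v w (igusa C) in
  let s0 := \sum_i v i ^+ 2 in let s1 := 2 * \sum_i v i * w i in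
  let s2 := \sum_i w i ^+ 2 in
  [/\ P`_0 = \sum_i v i ^+ 4 - 4^-1 * s0 ^+ 2,
      P`_1 = 4 * (\sum_i v i ^+ 3 * w i) - 4^-1 * (2 * s0 * s1) &
      P`_2 = 6 * (\sum_i v i ^+ 2 * w i ^+ 2) - 4^-1 * (s1 ^+ 2 + 2 * s0 * s2)].
Proof.
move=> v0 w0 P s0 s1 s2.
have sq : \sum_i ((v i)%:P + (w i)%:P * 'X) ^+ 2 =
    s0%:P + s1%:P * 'X + s2%:P * 'X^2 :> {poly C}.
  rewrite /s0 /s1 /s2 rmorphM !rmorph_sum /= mulr_sumr !mulr_suml -!big_split.
  apply: eq_bigr => i _ /=; rewrite !(rmorphM, rmorphXn, rmorph_nat) /=; ring.
have -> : P = \sum_i ((v i)%:P + (w i)%:P * 'X) ^+ 4 -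
    (4^-1)%:P * (s0%:P + s1%:P * 'X + s2%:P * 'X^2) ^+ 2.
  rewrite /P /igusa rmorphB /= line_polyZ rmorphXn /= -sq !(rmorph_sum (line_poly v w)) /=.
  congr (_ - _ * _ ^+ 2); apply: eq_bigr => i _;
    by rewrite rmorphXn /= line_poly_zcoord.
have [q0 q1 q2] := coef_square s0 s1 s2.
split; rewrite coefB coefCM ?q0 ?q1 ?q2 coef_sum; congr (_ - _).
- by apply: eq_bigr => i _; case: (coef_linear_pow4 (v i) (w i)).
- rewrite mulr_sumr; apply: eq_bigr => i _.
  by case: (coef_linear_pow4 (v i) (w i)) => _ ->; rewrite mulrA.
- rewrite mulr_sumr; apply: eq_bigr => i _.
  by case: (coef_linear_pow4 (v i) (w i)) => _ _ ->; rewrite mulrA.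
Qed.

Definition pencil_point (q : quadric_form C) (m : C) : quartic_form C :=
  quadricM q q + m *: DHomog (igusa_homog C).

Definition line_coef v w k (p : quartic_form C) : C := (line_poly v w p)`_k.

Lemma is_form_line_coef v w k : is_form 1 (line_coef v w k).
Proof.
apply: is_form_linear => c p1 p2.
by rewrite /line_coef /= rmorphD /= line_polyZ coefD coefCM.
Qed.

Lemma line_coef_pencil q m v w : \sum_j v j = 0 -> \sum_j w j = 0 ->
  let b k := (line_poly v w (igusa C))`_k in
  let c k := line_coef v w k (pencil_point q m) in
  [/\ c 0 = zeval q v ^+ 2 + m * b 0, c 1 = 2 * zeval q v * qmid q v w + m * b 1 &
      c 2 = qmid q v w ^+ 2 + 2 * zeval q v * zeval q w + m * b 2].
Proof.
move=> v0 w0 b c.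
have [q0 q1 q2] := coef_square (zeval q v) (qmid q v w) (zeval q w).
rewrite /c /line_coef /pencil_point /= rmorphD rmorphM /= line_polyZ.
rewrite line_poly_quadric // -expr2.
by split; rewrite coefD coefCM ?q0 ?q1 ?q2.
Qed.

Definition vec6 (s : seq C) (i : 'I_6) : C := s`_i.

Definition pt0 := vec6 [:: 1; 1; -2; -2; 1; 1].
Definition pt1 := vec6 [:: 2; 2; -1; -1; -1; -1].
Definition ptn := vec6 [:: 1; -1; 0; 0; 0; 0].

Lemma sum_pt0 : \sum_i pt0 i = 0.
Proof. by rewrite !big_ord_recl big_ord0 /pt0 /vec6 /=; ring. Qed.
Lemma sum_pt1 : \sum_i pt1 i = 0.
Proof. by rewrite !big_ord_recl big_ord0 /pt1 /vec6 /=; ring. Qed.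
Lemma sum_ptn : \sum_i ptn i = 0.
Proof. by rewrite !big_ord_recl big_ord0 /ptn /vec6 /=; ring. Qed.

(* [pt0] and [pt1] lie on a singular line of the Igusa quartic. *)
Lemma igusa_pt0 w : \sum_i w i = 0 ->
  (line_poly pt0 w (igusa C))`_0 = 0 /\ (line_poly pt0 w (igusa C))`_1 = 0.
Proof.
move=> w0; have [-> -> _] := line_poly_igusa sum_pt0 w0; split.
  by rewrite !big_ord_recl !big_ord0 /pt0 /vec6 /=; field.
(* The coordinates 1 and -2 of [pt0] are the roots of x^3 - 3 x + 2. *)
have -> : \sum_i pt0 i ^+ 3 * w i = 3 * (\sum_i pt0 i * w i) - 2 * (\sum_i w i).
  rewrite !mulr_sumr -sumrB !big_ord_recl !big_ord0 /pt0 /vec6 /=; ring.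
rewrite w0 (_ : \sum_i pt0 i ^+ 2 = 12); first by field.
by rewrite !big_ord_recl !big_ord0 /pt0 /vec6 /=; ring.
Qed.

Lemma igusa_pt0_pt1 : (line_poly pt0 pt1 (igusa C))`_2 = 0.
Proof.
have [_ _ ->] := line_poly_igusa sum_pt0 sum_pt1.
by rewrite !big_ord_recl !big_ord0 /pt0 /pt1 /vec6 /=; field.
Qed.

Lemma igusa_pt0_ptn : (line_poly pt0 ptn (igusa C))`_2 = 0.
Proof.
have [_ _ ->] := line_poly_igusa sum_pt0 sum_ptn.
by rewrite !big_ord_recl !big_ord0 /pt0 /ptn /vec6 /=; field.
Qed.

Lemma igusa_pt1_ptn (P := line_poly pt1 ptn (igusa C)) :
  [/\ P`_0 = 0, P`_1 = 0 & P`_2 = 36].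
Proof.
have [-> -> ->] := line_poly_igusa sum_pt1 sum_ptn.
by split; rewrite !big_ord_recl !big_ord0 /pt1 /ptn /vec6 /=; field.
Qed.


(* Let p = a^2 + m b.  Along a line v + t w, the coefficients of p in degrees *)
(* 0, 1, 2 are a(v)^2, 2 a(v) a1 and a1^2 + 2 a(v) a(w) + m b2, if b is        *)
(* singular at v; eliminating a1 and taking v = [pt0] expresses a(v)^3 a(w)    *)
(* through p and m b2.  As b2 = 0 for w = [pt1], [ptn], this determines        *)
(* a(v)^3 a(pt1) and a(v)^3 a(ptn); the line [pt1] + t [ptn], for which        *)
(* b2 = 36, then determines m, hence all the products a(w) a(w').              *)
Lemma pencil_recovery : exists e (D : quartic_form C -> C)
    (A : 'I_6 -> 'I_6 -> quartic_form C -> C) (M : quartic_form C -> C),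
  [/\ is_form e D, forall i j, is_form e.+1 (A i j), is_form e.+1 M,
    forall q m, let p := pencil_point q m in
      M p = D p * m /\ forall i j, A i j p =
        D p * ((\sum_k rowsum (qcoef q) k) * qcoef q i j) &
    exists q, D (pencil_point q 0) != 0].
Proof.
pose P0 := line_coef pt0 pt1 0; pose P1 := line_coef pt1 ptn 0.
pose N w (p : quartic_form C) := P0 p * line_coef pt0 w 2 p - 4^-1 * line_coef pt0 w 1 p ^+ 2.
pose Dm (p : quartic_form C) := 36 * (P1 p * P0 p ^+ 3).
pose M0 (p : quartic_form C) := P0 p ^+ 3 * (P1 p * line_coef pt1 ptn 2 p -
  4^-1 * line_coef pt1 ptn 1 p ^+ 2) - 2 * (P1 p * ((2^-1 * N pt1 p) * (2^-1 * N ptn p))).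
pose b2 w := (line_poly pt0 w (igusa C))`_2.
pose R w (p : quartic_form C) := 2^-1 * (Dm p * N w p - b2 w * (P0 p * M0 p)).
have hP0 : is_form 1 P0 := is_form_line_coef _ _ _.
have hP1 : is_form 1 P1 := is_form_line_coef _ _ _.
have hN w : is_form 2 (N w).
  apply: is_formB; first exact: is_formM hP0 (is_form_line_coef _ _ _).
  exact: is_formZ (is_formX 2 (is_form_line_coef _ _ _)).
have hDm : is_form 4 Dm by apply/is_formZ; exact: is_formM hP1 (is_formX 3 hP0).
have hM0 : is_form 5 M0.
  apply: is_formB.
    apply: is_formM (is_formX 3 hP0) _; apply: is_formB.
      exact: is_formM hP1 (is_form_line_coef _ _ _).
    exact: is_formZ (is_formX 2 (is_form_line_coef _ _ _)).
  apply: is_formZ; apply: is_formM hP1 _.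
  exact: is_formM (is_formZ _ (hN _)) (is_formZ _ (hN _)).
have hR w : is_form 6 (R w).
  apply: is_formZ; apply: is_formB; first exact: is_formM hDm (hN w).
  by apply: is_formZ; exact: is_formM hP0 hM0.
have P0E q m : P0 (pencil_point q m) = zeval q pt0 ^+ 2.
  rewrite /P0; have [-> _ _] := line_coef_pencil q m sum_pt0 sum_pt1.
  by have [-> _] := igusa_pt0 sum_pt1; rewrite mulr0 addr0.
have [b0 b1 b22] := igusa_pt1_ptn.
have P1E q m : P1 (pencil_point q m) = zeval q pt1 ^+ 2.
  rewrite /P1; have [-> _ _] := line_coef_pencil q m sum_pt1 sum_ptn.
  by rewrite b0 mulr0 addr0.
(* The combination c_0 c_2 - c_1^2 / 4 eliminates the polar term [qmid]. *)
have NE q m w : \sum_i w i = 0 -> N w (pencil_point q m) =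
    2 * zeval q pt0 ^+ 3 * zeval q w + m * zeval q pt0 ^+ 2 * b2 w.
  move=> w0; have [_ e1 e2] := line_coef_pencil q m sum_pt0 w0.
  rewrite /N P0E e1 e2; have [_ ->] := igusa_pt0 w0; rewrite -/(b2 w).
  by field.
have DmE q m : Dm (pencil_point q m) = 36 * zeval q pt1 ^+ 2 * zeval q pt0 ^+ 6.
  by rewrite /Dm P0E P1E; ring.
have M0E q m : M0 (pencil_point q m) = Dm (pencil_point q m) * m.
  have [_ e1 e2] := line_coef_pencil q m sum_pt1 sum_ptn.
  rewrite DmE /M0 P0E P1E e1 e2 b1 b22 !NE ?sum_pt1 ?sum_ptn //.
  rewrite /b2 igusa_pt0_pt1 igusa_pt0_ptn.
  by field.
have RE q m w : \sum_i w i = 0 ->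
    R w (pencil_point q m) = Dm (pencil_point q m) * zeval q pt0 ^+ 3 * zeval q w.
  by move=> w0; rewrite /R M0E NE // P0E; field.
(* A is a product of two values R, so the unknown sign of a cancels. Degrees: 3 + 2 * 4 = 11 for D,
   6 + 6 = 12 for A and 3 + 4 + 5 = 12 for M. *)
exists 11, (fun p : quartic_form C => P0 p ^+ 3 * Dm p ^+ 2),
  (fun i j (p : quartic_form C) => (\sum_k \sum_l R (dvec C k l) p) * R (dvec C i j) p),
  (fun p : quartic_form C => P0 p ^+ 3 * (Dm p * M0 p)); split.
- exact: is_formM (is_formX 3 hP0) (is_formX 2 hDm).
- move=> i j; apply: (is_formM (d := 6) (e := 6) _ (hR _)).
  by apply: is_form_sum => k; apply: is_form_sum.
- exact: is_formM (is_formX 3 hP0) (is_formM hDm hM0).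
- move=> q m p; split=> [|i j]; first by rewrite /p M0E; ring.
  have -> : \sum_k \sum_l R (dvec C k l) p =
      - (Dm p * zeval q pt0 ^+ 3 * \sum_k rowsum (qcoef q) k).
    rewrite mulr_sumr -sumrN; apply: eq_bigr => k _; rewrite /rowsum mulr_sumr -sumrN.
    by apply: eq_bigr => l _; rewrite RE ?sum_dvec // /qcoef mulrN opprK.
  rewrite RE ?sum_dvec // -/p P0E /qcoef; ring.
(* D is non-zero for q = \sum z_i^2, which equals 12 at both [pt0] and [pt1]. *)
- have h2 : \sum_(i < 6) zcoord C i ^+ 2 \is 2.-homog.
    by rewrite rpred_sum // => i _; exact: zcoord_exp_homog.
  have hz v : \sum_i v i = 0 -> zeval (\sum_(i < 6) zcoord C i ^+ 2) v = \sum_i v i ^+ 2.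
    move=> v0; rewrite /zeval (raddf_sum (meval _)); apply: eq_bigr => i _.
    by rewrite /= !expr2 mevalM -!/(zeval _ v) zeval_zcoord.
  exists (DHomog h2); rewrite DmE P0E /= !hz ?sum_pt0 ?sum_pt1 //.
  have -> : \sum_i pt0 i ^+ 2 = 12%:R.
    by rewrite !big_ord_recl big_ord0 /pt0 /vec6 /=; ring.
  have -> : \sum_i pt1 i ^+ 2 = 12%:R.
    by rewrite !big_ord_recl big_ord0 /pt1 /vec6 /=; ring.
  by rewrite !(mulf_neq0, expf_neq0) // pnatr_eq0.
Qed.

End Recovery.

(** * Parametrization of the Igusa pencils *)

Section PencilParameters.
Variables (C : numClosedFieldType) (k : nat).

(** Both varieties at once: k = 1 has the coordinate m of E_6-quartics, and k = 0 gives double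
    quadrics, where the sum in [quartic_of] is empty. *)
Definition params := (quadric_form C * ('I_k -> C))%type.
Implicit Types x : params.

Definition coef_al x : 'I_6 -> 'I_6 -> C := qcoef x.1.
Definition coef_z x : 'I_k -> C := x.2.

Definition quartic_of x : quartic_form C := pencil_point x.1 (\sum_i x.2 i).

Definition edge_sum x : C := \sum_i nodes coef_al x i.

Local Notation pgen := (param_gen coef_al coef_z).

Fact coef_al_edge x : edge_matrix (coef_al x).
Proof. exact: quadric_edge_matrix. Qed.

Definition param_line x1 x2 (t : C) : params :=
  (x1.1 + t *: (x2.1 - x1.1), fun j => x1.2 j + t * (x2.2 j - x1.2 j)).

Lemma param_line0 x1 x2 : param_line x1 x2 0 = x1.
Proof.
case: x1 => q m; congr pair; first by rewrite scale0r addr0.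
by apply/funext => j; rewrite mul0r addr0.
Qed.

Lemma param_line1 x1 x2 : param_line x1 x2 1 = x2.
Proof.
rewrite (surjective_pairing x2); congr pair; first by rewrite scale1r subrKC.
by apply/funext => j; rewrite mul1r subrKC.
Qed.

Lemma qcoefD (c : C) (q r : quadric_form C) i j :
  qcoef (q + c *: r : quadric_form C) i j = qcoef q i j + c * qcoef r i j.
Proof. by rewrite addrC qcoef_linear addrC. Qed.

Lemma param_line_poly x1 x2 i :
  polyfun (fun (_ : unit) t => t) (fun t => pgen i (param_line x1 x2 t)).
Proof.
have hid := polyfun_gen (fun (_ : unit) (t : C) => t) tt.
case: i => [[i j]|j] /=; last first.
  by apply: polyfunD; [exact: polyfun_const | apply: polyfunM => //; exact: polyfun_const].
apply: (@polyfun_eq _ _ _ _ (fun t =>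
    qcoef x1.1 i j + t * qcoef (x2.1 - x1.1 : quadric_form C) i j)).
  by apply: polyfunD; [exact: polyfun_const | apply: polyfunM => //; exact: polyfun_const].
by move=> t; rewrite -qcoefD.
Qed.

Lemma edge_sum_line x1 x2 t : edge_sum x1 = 1 -> edge_sum x2 = 1 ->
  edge_sum (param_line x1 x2 t) = 1.
Proof.
have e x : edge_sum x = \sum_i \sum_j qcoef x.1 i j by [].
have -> : edge_sum (param_line x1 x2 t) = edge_sum x1 + t * (edge_sum x2 - edge_sum x1).
  rewrite !e -sumrB mulr_sumr -big_split; apply: eq_bigr => i _ /=.
  rewrite -sumrB mulr_sumr -big_split; apply: eq_bigr => j _ /=.
  by rewrite /qcoef /zeval mevalD mevalZ mevalB; ring.
by move=> -> ->; rewrite subrr mulr0 addr0.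
Qed.

Lemma params_neq0M f1 f2 : polyfun pgen f1 -> polyfun pgen f2 ->
  (exists x, f1 x != 0) -> (exists x, f2 x != 0) -> exists x, f1 x != 0 /\ f2 x != 0.
Proof.
move=> h1 h2 [x1 e1] [x2 e2].
have [t ht] := polyfun_neq0M h1 h2 (param_line0 x1 x2) (param_line1 x1 x2)
  (param_line_poly x1 x2) e1 e2.
by exists (param_line x1 x2 t).
Qed.

Lemma slice_neq0M f1 f2 : polyfun pgen f1 -> polyfun pgen f2 ->
  (exists2 x, edge_sum x = 1 & f1 x != 0) -> (exists2 x, edge_sum x = 1 & f2 x != 0) ->
  exists2 x, edge_sum x = 1 & f1 x != 0 /\ f2 x != 0.
Proof.
move=> h1 h2 [x1 s1 e1] [x2 s2 e2].
have [t ht] := polyfun_neq0M h1 h2 (param_line0 x1 x2) (param_line1 x1 x2)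
  (param_line_poly x1 x2) e1 e2.
by exists (param_line x1 x2 t) => //; apply: edge_sum_line.
Qed.

Lemma polyfun_al i j : polyfun pgen (fun x => coef_al x i j).
Proof. exact: (polyfun_gen _ (inl (i, j))). Qed.

Lemma polyfun_nodes i : polyfun pgen (fun x => nodes coef_al x i).
Proof. by apply: polyfun_sum => j _; apply: polyfun_al. Qed.

Lemma polyfun_edge_sum : polyfun pgen edge_sum.
Proof. by apply: polyfun_sum => j _; apply: polyfun_nodes. Qed.

Lemma polyfun_tail j : polyfun pgen (fun x => tail_coord coef_al coef_z x j).
Proof.
case: j => [j|j]; last exact: (polyfun_gen _ (inr j)).
apply: polyfun_sum => i _; apply: polyfun_sum => l _; apply: polyfunM.
  exact: polyfun_al.
by apply: polyfunM; apply: polyfunX; apply: polyfun_nodes.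
Qed.

Lemma polyfun_slice_coord i : polyfun pgen (fun x => slice_coord coef_al coef_z x i).
Proof.
case: i => [i|j]; last exact: polyfun_tail.
by apply: polyfun_meval => j; apply: polyfun_nodes.
Qed.

(** Fixed quartics with coefficients polynomial in the parameters, so that every form in the quartic
    is a [polyfun] of them. *)
Lemma quartic_of_sum : exists b0 : 'I_6 * 'I_6 -> 'I_6 * 'I_6 -> quartic_form C,
  forall x, quartic_of x = 4^-1 *: (\sum_p \sum_r (coef_al x p.1 p.2 * coef_al x r.1 r.2) *: b0 p r)
    + (\sum_i x.2 i) *: DHomog (igusa_homog C).
Proof.
have zz_homog (p : 'I_6 * 'I_6) : zcoord C p.1 * zcoord C p.2 \is 2.-homog.
  by apply: (dhomogM (d := 1) (e := 1)); exact: zcoord_homog.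
pose zz p : quadric_form C := DHomog (zz_homog p).
exists (fun p r => quadricM (zz p) (zz r)) => y.
rewrite /quartic_of /pencil_point; congr (_ + _); apply: val_inj.
rewrite /= (quadric_expansion y.1) pair_big /= -scalerAl -scalerAr scalerA.
have -> : 2^-1 * 2^-1 = 4^-1 :> C by field.
congr (_ *: _); rewrite big_distrlr /=.
rewrite linear_sum /=; apply: eq_bigr => p _; rewrite linear_sum /=; apply: eq_bigr => r _.
by rewrite -scalerAl -scalerAr scalerA.
Qed.

Lemma polyfun_form d f : is_form d f -> polyfun pgen (fun x => f (quartic_of x)).
Proof.
move=> [P _ eP]; have [b0 eb] := quartic_of_sum.
apply: (@polyfun_eq _ _ _ _ (fun x => P.@[coords (quartic_of x)])) => //.
apply: polyfun_meval => i.
apply: (@polyfun_eq _ _ _ _ (fun x => 4^-1 * (\sum_p \sum_r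
   (coef_al x p.1 p.2 * coef_al x r.1 r.2) * coords (b0 p r) i)
   + (\sum_i x.2 i) * coords (DHomog (igusa_homog C)) i)); last first.
  move=> x; rewrite eb /coords linearD !linearZ linear_sum /=; congr (_ * _ + _).
  apply: eq_bigr => p _; rewrite linear_sum /=; apply: eq_bigr => r _.
  by rewrite linearZ.
apply: polyfunD.
  apply: polyfunZ; apply: polyfun_sum => p _; apply: polyfun_sum => r _.
  by do !(apply: polyfunM); [exact: polyfun_al|exact: polyfun_al|exact: polyfun_const].
apply: polyfunM; last exact: polyfun_const.
by apply: polyfun_sum => j _; exact: (polyfun_gen _ (inr j)).
Qed.

Lemma data_point Y (u : 'I_9 -> C) (z : 'I_k -> C) : injective Y ->
  exists2 x, nodes coef_al x = Y &
    tail_coord coef_al coef_z x = (fun j => match j with inl j => u j | inr j => z j end).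
Proof.
move=> Yinj; have [q [e1 e2]] := quadric_of_data Y u Yinj.
exists (q, z) => //; apply/funext => -[j|j] //.
by rewrite /= /nodes /coef_al /= e1 e2.
Qed.

Lemma param_scale x (c : C) : c != 0 -> exists2 y, edge_sum y = c * edge_sum x &
  quartic_of y = c ^+ 2 *: quartic_of x.
Proof.
move=> c0; exists (c *: x.1, fun j => c ^+ 2 * x.2 j).
  rewrite /edge_sum mulr_sumr; apply: eq_bigr => i _; rewrite mulr_sumr.
  by apply: eq_bigr => j _; rewrite /coef_al /qcoef /zeval /= mevalZ mulrN.
apply: val_inj; rewrite /= -mulr_sumr -!mul_mpolyC !(mpolyCM, rmorphXn) /=; ring.
Qed.

Lemma slice_nonempty : exists2 x, edge_sum x = 1 & injective (nodes coef_al x).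
Proof.
have [Y [w [sY Yinj _]]] := @exists_nodes C void (fun=> 1) (fun=> 0)
  (polyfun_const _ _) (oner_neq0 _).
by have [x eY _] := data_point (fun=> 0) (fun=> 0) Yinj; exists x; rewrite ?eY // /edge_sum eY.
Qed.

(** At some parameter both the form and the edge sum are non-zero; rescaling to edge sum 1
    multiplies the form by a non-zero constant. *)
Lemma form_slice_neq0 d f : is_form d f -> (exists x, f (quartic_of x) != 0) ->
  exists2 x, edge_sum x = 1 & f (quartic_of x) != 0.
Proof.
move=> hf hx; have [|x [fx tx]] := params_neq0M (polyfun_form hf) polyfun_edge_sum hx.
  by have [x e _] := slice_nonempty; exists x; rewrite e oner_eq0.
have [|y ty ey] := @param_scale x (edge_sum x)^-1; first by rewrite invr_eq0.
exists y; first by rewrite ty mulVf.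
by rewrite ey (is_form_scale _ _ hf) mulf_neq0 // !expf_neq0 // invr_eq0.
Qed.

Definition quadric_perm (s : 'S_6) (q : quadric_form C) : quadric_form C :=
  DHomog (permute_z_homog s (dhomog_is_dhomog q)).

Definition param_perm (s : 'S_6) x : params := (quadric_perm s x.1, x.2).

Lemma quartic_of_perm s x : quartic_act C (quartic_of x) s = quartic_of (param_perm s x).
Proof.
apply: val_inj; rewrite /= -{2}(permute_z_igusa C s) /permute_z.
by rewrite comp_mpolyD comp_mpolyZ rmorphM.
Qed.

Lemma nodes_perm s x : nodes coef_al (param_perm s x) = nodes coef_al x \o (s^-1)%g.
Proof.
apply/funext => i; rewrite /nodes /rowsum /= [RHS](reindex_inj (@perm_inj _ s^-1%g)) /=.
by apply: eq_bigr => j _; rewrite /coef_al /= qcoef_permute.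
Qed.

Lemma tail_perm s x : tail_coord coef_al coef_z (param_perm s x) =
  tail_coord coef_al coef_z x.
Proof.
apply/funext => -[j|j] //=; rewrite /basic_moment /moment nodes_perm.
rewrite [RHS](reindex_inj (@perm_inj _ s^-1%g)) /=; apply: eq_bigr => i _.
rewrite [RHS](reindex_inj (@perm_inj _ s^-1%g)) /=; apply: eq_bigr => l _.
by rewrite /coef_al /= qcoef_permute.
Qed.

Lemma edge_sum_perm s x : edge_sum (param_perm s x) = edge_sum x.
Proof. by rewrite /edge_sum nodes_perm [RHS](reindex_inj (@perm_inj _ s^-1%g)). Qed.

Lemma esyms_perm s x : esyms (nodes coef_al (param_perm s x)) = esyms (nodes coef_al x).
Proof.
rewrite nodes_perm; apply/funext => i; rewrite /esyms -meval_msym.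
by have /issymP -> := mesym_sym 6 C i.+1.
Qed.

End PencilParameters.

(** * Coordinates on the slice and the three conditions of the criterion *)

Lemma quartic_act1 (C : numClosedFieldType) (w : quartic_form C) :
  quartic_act C w 1%g = w.
Proof. exact: quartic_perm_id. Qed.

Lemma quartic_actM (C : numClosedFieldType) (w : quartic_form C) s t :
  quartic_act C (quartic_act C w s) t = quartic_act C w (s * t)%g.
Proof. by apply: val_inj; rewrite /= permute_zM. Qed.

Section Rationality.
Variables (C : numClosedFieldType) (k : nat).
Hypothesis k_le1 : (k <= 1)%N.

(** The denominator D of [pencil_recovery] is replaced by the product of its conjugates under S_6,
    and A and M are multiplied by the same extra factor K. *)
Lemma invariant_recovery : exists e (D : quartic_form C -> C)
    (A : 'I_6 -> 'I_6 -> quartic_form C -> C) (M : quartic_form C -> C),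
  [/\ is_form e D /\ is_form e.+1 M, forall i j, is_form e.+1 (A i j),
    forall s w, D (quartic_act C w s) = D w,
    forall x : params C k, M (quartic_of x) = D (quartic_of x) * (\sum_i x.2 i) /\
      forall i j, A i j (quartic_of x) = D (quartic_of x) * (edge_sum x * coef_al x i j) &
    exists x : params C k, D (quartic_of x) != 0].
Proof.
have [e [D [A [M [hD hA hM rec [q0 D0]]]]]] := pencil_recovery C.
have hact s : is_form e (fun w => D (quartic_act C w s)).
  exact: (is_form_act (E6_quartics C) s hD).
pose r := [seq s <- index_enum 'S_6 | s != 1%g].
pose K w := \prod_(s <- r) D (quartic_act C w s).
have hK : is_form (\sum_(s <- r) e)%N K by apply: is_form_prod.
have DK w : D w * K w = \prod_(s : 'S_6) D (quartic_act C w s).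
  rewrite (bigD1 (1%g : 'S_6)) //= /K big_filter; congr (D _ * _).
  by rewrite -[w in LHS]quartic_act1.
exists (e + \sum_(s <- r) e)%N, (fun w => D w * K w), (fun i j w => A i j w * K w),
  (fun w => M w * K w); split.
- by split; [exact: is_formM | rewrite -addSn; exact: is_formM].
- by move=> i j; rewrite -addSn; exact: is_formM.
- move=> s w; rewrite !DK [RHS](reindex_inj (@mulgI _ s)).
  by apply: eq_bigr => t _; congr D; exact: quartic_actM.
- move=> x; have [eM eA] := rec x.1 (\sum_i x.2 i).
  by split=> [|i j]; [rewrite eM | rewrite eA]; rewrite mulrAC.
suff [x hx] : exists x : params C k,
    \prod_(s <- index_enum 'S_6) D (quartic_act C (quartic_of x) s) != 0.
  by exists x; rewrite DK.
elim: (index_enum _) => [|s r' [x1 IH]].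
  by exists (q0, fun=> 0); rewrite big_nil oner_neq0.
have pf f d : is_form d f ->
    polyfun (param_gen (@coef_al C k) (@coef_z C k)) (fun x => f (quartic_of x)).
  exact: polyfun_form.
have [||x [h1 h2]] := params_neq0M (pf _ _ (hact s)) (pf _ _ (is_form_prod r' hact)).
- exists (param_perm s^-1%g (q0, fun=> 0)).
  rewrite -quartic_of_perm quartic_actM mulVg quartic_act1.
  by rewrite /quartic_of big1.
- by exists x1.
by exists x; rewrite big_cons mulf_neq0.
Qed.

Variable X : gvariety 'S_6 (quartic_form C).
Hypothesis act_X : gv_act X = quartic_act C.
Hypothesis X_param : forall w, gv_pts X w -> exists x : params C k, w = quartic_of x.
Hypothesis param_X : forall x : params C k, x.1 != 0 -> gv_pts X (quartic_of x).

Definition slice := {x : params C k | edge_sum x = 1}.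

Definition coord_index : finType := ('I_5 + ('I_9 + 'I_k))%type.

Definition slice_coords (x : slice) (i : 'I_#|coord_index|) : C :=
  slice_coord (@coef_al C k) (@coef_z C k) (sval x) (enum_val i).

Lemma polyfun_coord_mpoly h : polyfun (fun i (t : coord_index -> C) => t i) h ->
  exists P : {mpoly C[#|coord_index|]}, forall t, h t = P.@[fun i => t (enum_val i)].
Proof.
move=> hh; pose r (u : 'I_#|coord_index| -> C) (i : coord_index) := u (enum_rank i).
have hr i : polyfun (fun j (u : 'I_#|coord_index| -> C) => u j) (fun u => r u i).
  exact: (polyfun_gen (fun j (u : 'I_#|coord_index| -> C) => u j)).
have [P eP] := polyfun_mpoly (polyfun_comp (r := r) hh hr).
exists P => t; rewrite -eP; congr h; apply/funext => i.
by rewrite /r enum_rankK.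
Qed.

Lemma slice_pts (x : slice) : gv_pts X (quartic_of (sval x)).
Proof.
apply: param_X; apply: contra_eq_neq (svalP x) => q0.
rewrite eq_sym /edge_sum big1 ?oner_eq0 // => i _.
by apply: big1 => j _; rewrite /coef_al q0 /qcoef /zeval meval0 oppr0.
Qed.

Lemma slice_dense d f : is_form d f -> (forall x : slice, f (quartic_of (sval x)) = 0) ->
  forall w, gv_pts X w -> f w = 0.
Proof.
move=> hf f0 w /X_param[x ->]; apply/eqP/negPn/negP => fx.
have [|y ty /negP[]] := @form_slice_neq0 C k d f hf; first by exists x.
by have := f0 (exist _ y ty); rewrite /= => ->.
Qed.

(** [exists_nodes] and [data_point] produce a slice point whose coordinates avoid the zeros of g; on
    the line joining it to a point where f is non-zero, both are non-zero somewhere. *)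
Lemma slice_independent d f (g : {mpoly C[#|coord_index|]}) : is_form d f ->
  (exists x : slice, f (quartic_of (sval x)) != 0) -> g != 0 ->
  exists2 x : slice, f (quartic_of (sval x)) != 0 & g.@[slice_coords x] != 0.
Proof.
move=> hf [[x1 t1] /= fx1] /mpoly_nonroot[v gv].
pose G (t : coord_index -> C) := g.@[fun i => t (enum_val i)].
have hG : polyfun (fun i (t : coord_index -> C) => t i) G.
  by apply: polyfun_meval => i; exact: (polyfun_gen (fun i (t : coord_index -> C) => t i)).
have Gt : G (fun i => v (enum_rank i)) != 0.
  by rewrite /G (meval_eq (v2 := v)) // => i; rewrite enum_valK.
have [Y [w [sY Yinj GY]]] := exists_nodes hG Gt.
have [x2 en et] := data_point (fun j => w (inl j)) (fun j => w (inr j)) Yinj.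
have ex2 : slice_coord (@coef_al C k) (@coef_z C k) x2 = slice_point Y w.
  rewrite /slice_coord en et; congr slice_point; apply/funext => -[] //.
have [|||x tx [fx gx]] := @slice_neq0M C k (fun x => f (quartic_of x))
    (fun x => G (slice_coord (@coef_al C k) (@coef_z C k) x)) (polyfun_form k hf).
- exact: (polyfun_comp hG (@polyfun_slice_coord C k)).
- by exists x1.
- by exists x2; rewrite ?ex2 // /edge_sum en.
by exists (exist _ x tx).
Qed.

Lemma invariant_on_params d f : is_form d f -> is_invariant X f ->
  forall (s : 'S_6) (x : params C k), exists x',
  [/\ nodes (@coef_al C k) x' = nodes (@coef_al C k) x \o s,
    tail_coord (@coef_al C k) (@coef_z C k) x' = tail_coord (@coef_al C k) (@coef_z C k) x &
    f (quartic_of x') = f (quartic_of x)].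
Proof.
move=> hf If s x; exists (param_perm s^-1%g x).
rewrite nodes_perm tail_perm invgK; split=> //.
(* A parameter with zero quadric is not known to give a point of [X], but [param_perm] fixes it. *)
have [q0|q0] := eqVneq x.1 0; last first.
  by rewrite -quartic_of_perm -act_X If //; apply: param_X.
congr (f (quartic_of _)); rewrite /param_perm [RHS]surjective_pairing q0; congr pair.
by apply: val_inj; rewrite /= /permute_z comp_mpoly0.
Qed.

Lemma slice_generate d f h : is_form d f -> is_form d h ->
  is_invariant X f -> is_invariant X h ->
  (exists x : slice, h (quartic_of (sval x)) != 0) ->
  exists2 AB : {mpoly C[#|coord_index|]} * {mpoly C[#|coord_index|]},
    exists x, AB.2.@[slice_coords x] != 0 &
    forall x : slice, f (quartic_of (sval x)) * AB.2.@[slice_coords x] =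
      h (quartic_of (sval x)) * AB.1.@[slice_coords x].
Proof.
move=> hf hh If Ih [[x0 tx0] /= hx0].
have gen g : is_form d g -> is_invariant X g -> exists N, forall n,
    exists G : {mpoly C[#|coord_index|]}, forall x : slice,
    node_disc (nodes (@coef_al C k) (sval x)) ^+ (n + N) * g (quartic_of (sval x)) =
    G.@[slice_coords x].
  move=> hg Ig.
  have [N hN] := invariant_generation (@coef_al_edge C k) (polyfun_form k hg)
    (invariant_on_params hg Ig).
  exists N => n; have [G0 /polyfun_coord_mpoly[G eG] e] := hN n.
  by exists G => -[x tx]; rewrite /= e // eG.
have [Nf genf] := gen f hf If; have [Nh genh] := gen h hh Ih.
(* Both functions are cleared by the power Nf + Nh of the discriminant, which cancels in the
   quotient. *)
have [A eA] := genf Nh; have [B eB] := genh Nf.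
exists (A, B) => [|x] /=; last first.
  by rewrite -eA -eB addnC; ring.
have hd : polyfun (param_gen (@coef_al C k) (@coef_z C k))
    (fun x => node_disc (nodes (@coef_al C k) x)).
  by apply: polyfun_node_disc => i; apply: polyfun_nodes.
have [||x tx [dx hx]] := slice_neq0M hd (polyfun_form k hh).
- have [x tx xinj] := slice_nonempty C k.
  by exists x => //; apply: node_disc_neq0.
- by exists x0.
by exists (exist _ x tx); rewrite -eB mulf_neq0 // expf_neq0.
Qed.

(** A, its row sums y and its total E carry the common factor [c], and E = c on the slice. An
    expression homogeneous of degree n in the matrix is therefore its value at A divided by E^n,
    with n = 1 + a + b for the moment L_ab. *)
Lemma slice_numerators i : exists d f h,
  [/\ is_form d f /\ is_form d h, is_invariant X f, is_invariant X h,
      exists x : slice, h (quartic_of (sval x)) != 0 &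
      forall x : slice, f (quartic_of (sval x)) =
        h (quartic_of (sval x)) * slice_coords x i].
Proof.
have [e [D [A [M [[hD hM] hA Dinv rec Dneq0]]]]] := invariant_recovery.
have [xD tD xDneq0] := form_slice_neq0 hD Dneq0.
pose y w i := \sum_j A i j w.
pose E w := \sum_i y w i.
have hy j : is_form e.+1 (fun w => y w j) by apply: is_form_sum.
have hE : is_form e.+1 E by apply: is_form_sum.
pose c (x : params C k) := D (quartic_of x) * edge_sum x.
have AE x i' j : A i' j (quartic_of x) = c x * coef_al x i' j.
  by rewrite (rec x).2 mulrA.
have yE x j : y (quartic_of x) j = c x * nodes (@coef_al C k) x j.
  by rewrite /y /nodes /rowsum mulr_sumr; apply: eq_bigr => l _.
have EE x : E (quartic_of x) = c x * edge_sum x.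
  by rewrite /E /edge_sum mulr_sumr; apply: eq_bigr => l _.
have inv_of (f : quartic_form C -> C) (tau : params C k -> C) :
    (forall x, f (quartic_of x) = tau x) -> (forall s x, tau (param_perm s x) = tau x) ->
    is_invariant X f.
  move=> ef et s w /X_param[x ->].
  by rewrite act_X quartic_of_perm !ef et.
have c_perm s x : c (param_perm s x) = c x.
  by rewrite /c -quartic_of_perm Dinv edge_sum_perm.
have E_inv n : is_invariant X (fun w => E w ^+ n).
  apply: (inv_of _ (fun x => (c x * edge_sum x) ^+ n)) => [x|s x]; first by rewrite EE.
  by rewrite c_perm edge_sum_perm.
have E_neq0 n : exists x : slice, E (quartic_of (sval x)) ^+ n != 0.
  exists (exist _ xD tD); rewrite expf_neq0 //= EE /c.
  by rewrite tD !mulr1.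
have cE (x : slice) : E (quartic_of (sval x)) = c (sval x) by rewrite EE (svalP x) mulr1.
rewrite /slice_coords; case: (enum_val i) => [l|[l|l]] /=.
(* The index runs over e_2, ..., e_6, since e_1 is constant on the slice. *)
- pose n := (lift ord0 l : 'I_6).+1.
  have fE x : (mesym 6 C n).@[y (quartic_of x)] =
      c x ^+ n * esyms (nodes (@coef_al C k) x) (lift ord0 l).
    rewrite -(meval_homog_scale _ _ (dhomog_mesym _ _ n)); apply: meval_eq => j.
    exact: yE.
  exists (e.+1 * n)%N, (fun w => (mesym 6 C n).@[y w]), (fun w => E w ^+ n); split=> //.
  + by split; [apply: is_form_meval => //; exact: dhomog_mesym | exact: is_formX].
  + apply: (inv_of _ _ fE) => s x; by rewrite c_perm esyms_perm.
  + by move=> x; rewrite fE cE.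
- set a := (basic_pair l).1; set b := (basic_pair l).2.
  pose f w := moment (y w) (fun i j => A i j w) a b.
  have fE x : f (quartic_of x) = c x ^+ (1 + (a + b)) *
      tail_coord (@coef_al C k) (@coef_z C k) x (inl l).
    rewrite /f /= /basic_moment /moment mulr_sumr; apply: eq_bigr => p _.
    rewrite mulr_sumr; apply: eq_bigr => q _; rewrite !yE AE -/a -/b; move: (c x) => cx.
    by rewrite !exprMn !exprD expr1; ring.
  exists (e.+1 * (1 + (a + b)))%N, f, (fun w => E w ^+ (1 + (a + b))); split=> //.
  + split; last exact: is_formX.
    rewrite !mulnDr muln1; apply: is_form_sum => p; apply: is_form_sum => q.
    by apply: is_formM => //; apply: is_formM; exact: is_formX.
  + apply: (inv_of _ _ fE) => s x; by rewrite c_perm tail_perm.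
  + by move=> x; rewrite fE cE.
- exists e.+1, M, (fun w => E w ^+ 1); split=> //.
  + apply: (inv_of _ (fun x => D (quartic_of x) * \sum_i x.2 i)) => [x|s x].
      by case: (rec x).
    by rewrite -quartic_of_perm Dinv.
  + move=> x; rewrite (rec (sval x)).1 cE /c (svalP x) mulr1 expr1; congr (_ * _).
    have ord0 (j : 'I_k) : nat_of_ord j = 0%N.
      by have := leq_trans (ltn_ord j) k_le1; rewrite ltnS leqn0 => /eqP.
    rewrite (bigD1 l) //= big1 ?addr0 // => j /negP[]; apply/eqP/val_inj => /=.
    by rewrite !ord0.
Qed.

Lemma param_gvariety_rational : git_quotient_rational X.
Proof.
exact: (rational_by_coordinates slice_pts slice_dense slice_numerators
  slice_independent slice_generate).
Qed.

End Rationality.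

(** * The two moduli spaces *)

Section E6Rationality.
Variable C : numClosedFieldType.

Lemma E6_quartics_rational : git_quotient_rational (E6_quartics C).
Proof.
apply: (@param_gvariety_rational C 1) => // [w [a a0 [l [m [_ e]]]]|[q z] /= q0].
  (* The scalar is absorbed into the quadric; l = 0 gives the zero quadric, which [params]
     allows. *)
  exists (sqrtC l *: a, fun=> m); apply: val_inj; rewrite /= e big_ord1; congr (_ + _).
  by rewrite -scalerAl -scalerAr scalerA -expr2 sqrtCK expr2.
exists q => //; exists 1, (\sum_i z i); split; first by rewrite xpair_eqE oner_eq0.
by rewrite scale1r expr2.
Qed.

Lemma double_quadrics_rational : git_quotient_rational (double_quadrics C).
Proof.
apply: (@param_gvariety_rational C 0) => // [w [a [l [a0 _ e]]]|[q z] /= q0].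
  exists (sqrtC l *: a, fun=> 0); apply: val_inj.
  by rewrite /= e big_ord0 scale0r addr0 -scalerAl -scalerAr scalerA -expr2 sqrtCK expr2.
by exists q, 1; rewrite oner_eq0 scale1r /= big_ord0 scale0r addr0 expr2.
Qed.

End E6Rationality.

Theorem theoremC (R : realType) :
  git_quotient_rational (E6_quartics R[i]) /\
  git_quotient_rational (double_quadrics R[i]).
Proof. by split; [exact: E6_quartics_rational | exact: double_quadrics_rational]. Qed.
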